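(* Let $L$ be an oriented link diagram which is connected, prime-like and has no nugatory crossings, and fix a segment $i$ of $L$. Let $G_{L,i}$ be the truncated face-crossing incidence graph (which has property $( * )$), and let $D_{G_{L,i}}(t)$ be obtained from the dimer face polynomial $D_{G_{L,i}}(\mathbf{y})$ by the specialization, for each face $f_j$ of $G_{L,i}$ (containing segment $j$), \[ y_j \mapsto \begin{cases} -t & \text{if segment } j \text{ exits an undercrossing and enters an overcrossing},\\ -t^{-1} & \text{if segment } j \text{ exits an overcrossing and enters an undercrossing},\\ -1 & \text{otherwise.}\end{cases} \] Then \[ D_{G_{L,i}}(t)=\Big((-1)^{b(\hat{0})}\langle L|\hat{0}\rangle^{-1}\Big)\sum_{S\in\mathcal{S}_{L,i}}(-1)^{b(S)}\langle L|S\rangle , \] and in particular $D_{G_{L,i}}(t)\sim \Delta_L(t)$, where $\Delta_L$ is the Alexander polynomial of $L$ and $P\sim Q$ means $P=\pm t^kQ$ for some integer $k$.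
   Context: Link diagrams: a segment of $L$ is a curve of the diagram between two consecutive crossings; segments are oriented by the orientation of $L$. $L$ is connected if the diagram has one connected component; prime-like if there is no simple closed curve meeting $L$ in exactly two points with crossings of $L$ both inside and outside it; a crossing $c$ is nugatory if some simple closed curve meets $L$ only at $c$. Face-crossing incidence graph $G_L$: a black vertex $b_c$ on each crossing $c$, a white vertex $w_r$ in each planar region $r$, and an edge $(b_c,w_r)$ iff crossing $c$ touches region $r$. Its faces are in bijection with segments; $f_j$ is the face containing segment $j$. Drawing $L$ so that segment $i$ borders the exterior region (so $f_i$ is the infinite face), $G_{L,i}$ is obtained from $G_L$ by deleting the two white vertices of $f_i$ (the regions adjacent to segment $i$). Dimer notions: for a finite connected bipartite plane graph $G$ with fixed black/white proper coloring, property $( * )$ means every edge lies in some perfect matching. For a bounded face $f$ with cycle boundary, an edge of $f$ is black-white if, going clockwise around $f$, one meets its black endpoint first; otherwise white-black. If a perfect matching $M$ contains all black-white edges of $f$, the down-flip at $f$ replaces them by the white-black edges of $f$ (the inverse is an up-flip). Perfect matchings, ordered by $M\le M'$ iff $M$ is obtained from $M'$ by down-flips, form a distributive lattice with minimum $\hat 0$. For a saturated chain $\hat0=M_0\lessdot\cdots\lessdot M_\ell=M$ with $M_{k-1},M_k$ related by a flip at face $f_k$, $\mathrm{mrk}(M)=y_{f_1}\cdots y_{f_\ell}$ (independent of the chain), and the dimer face polynomial is $D_G=\sum_M\mathrm{mrk}(M)$. Kauffman states: the two regions adjacent to segment $i$ are absent, the others present. A state $S\in\mathcal{S}_{L,i}$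 is a bijection from crossings to present regions sending each crossing to a region it touches (a marker in that corner). At each crossing, rotated so the under-strand points upward, the four corners have weights: upper-left $t$, lower-left $-t$, upper-right $-1$, lower-right $1$ (independent of the over-strand orientation). $\langle L|S\rangle$ is the product of the weights of the marked corners. A marker is a black hole if it lies in the corner bounded by the two incoming half-strands at the crossing; $b(S)$ is the number of black holes. States correspond bijectively to perfect matchings of $G_{L,i}$ via $S\mapsto\{(b_c,w_r): \text{the marker of }c\text{ is in }r\}$; $\hat 0$ also denotes the state corresponding to the minimal matching. *)

(* Defs.v *)
From Stdlib Require Import ClassicalEpsilon.
From HB Require Import structures.
From mathcomp Require Import all_boot all_order all_fingroup all_algebra.
From mathcomp Require Import fraction mpoly.

Set Implicit Arguments.
Unset Strict Implicit.
Unset Printing Implicit Defensive.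

Import GRing.Theory.
Local Open Scope ring_scope.

(** * Dimers on bipartite plane graphs *)

(* The part of a bipartite plane graph that the dimer notions depend on.  The
   embedding enters through the boundaries of the faces: [bw f] (resp. [wb f])
   is the set of edges of [f] whose black (resp. white) endpoint is met first
   when going clockwise around [f], i.e. when walking with [f] on the right. *)
Record bip_plane_graph (B W F : finType) := BipPlaneGraph {
  white : {set W};
  edges : {set B * W};
  faces : {set F};
  bw : F -> {set B * W};
  wb : F -> {set B * W} }.

Section Dimers.
Variables (B W F : finType) (G : bip_plane_graph B W F).

(* Deletion of a set of white vertices lying on a common face: the faces that
   are incident to a deleted vertex all merge with that face, which is taken to
   be the infinite one; the other faces are unchanged, and they are bounded. *)
Definition delete_white (A : {set W}) : bip_plane_graph B W F :=
  {| white := white G :\: A;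
     edges := [set e in edges G | e.2 \notin A];
     faces := [set f in faces G | [forall e in bw G f :|: wb G f, e.2 \notin A]];
     bw := bw G;
     wb := wb G |}.

Definition perfect_matching (M : {set B * W}) : bool :=
  [&& M \subset edges G,
      [forall b : B, #|[set e in M | e.1 == b]| == 1%N] &
      [forall w in white G, #|[set e in M | e.2 == w]| == 1%N]].

Definition down_flip (f : F) (M M' : {set B * W}) : bool :=
  [&& perfect_matching M, perfect_matching M', f \in faces G,
      bw G f \subset M & M' == (M :\: bw G f) :|: wb G f].

Definition down_flip_rel : rel {set B * W} :=
  [rel M M' | [exists f, down_flip f M M']].

Definition matching_le (M M' : {set B * W}) : bool := connect down_flip_rel M' M.

Definition is_minimum (M : {set B * W}) : bool :=
  perfect_matching M &&
  [forall M' : {set B * W}, perfect_matching M' ==> matching_le M M'].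

Definition min_matching : {set B * W} := odflt set0 [pick M | is_minimum M].

(* A sequence of up-flips, at the successive faces of [fs], from [M] to [M']. *)
Fixpoint flip_chain (M : {set B * W}) (fs : seq F) (M' : {set B * W}) : bool :=
  if fs is f :: fs' then [exists N, down_flip f N M && flip_chain N fs' M']
  else M == M'.

Definition chain_to (M : {set B * W}) : seq F :=
  epsilon (inhabits [::]) (fun fs => flip_chain min_matching fs M).

(* The variable [y_f] is ['X_(enum_rank f)]. *)
Definition mrk (M : {set B * W}) : {mpoly int[#|F|]} :=
  \prod_(f <- chain_to M) 'X_(enum_rank f).

Definition dimer_face_poly : {mpoly int[#|F|]} :=
  \sum_(M : {set B * W} | perfect_matching M) mrk M.

End Dimers.

(** * Link diagrams *)

(* [(c, k)] is the [k]-th half-strand at the crossing [c], in counterclockwise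
   order.  When [c] is drawn with its under-strand pointing upward, the
   half-strands 0, 1, 2, 3 are at the bottom, right, top and left: the
   under-strand goes from 0 to 2, and the over-strand from 3 to 1 if [c] is
   positive, from 1 to 3 otherwise.
   [(c, k)] also denotes the corner of [c] between the half-strands [k] and
   [k + 1 mod 4], so the corners 0, 1, 2, 3 are the lower-right, upper-right,
   upper-left and lower-left ones. *)
Section CombinatorialMap.
Variables (C : finType) (pos : pred C) (opp : {perm C * 'I_4}).

Definition incoming_at (h : C * 'I_4) : bool :=
  ((h.2 == 0 :> nat) || (h.2 == (if pos h.1 then 3 else 1) :> nat))%N.

Definition turn_fun (h : C * 'I_4) : C * 'I_4 := (h.1, ord_pred h.2).

Lemma turn_inj : injective turn_fun.
Proof.
apply: (can_inj (g := fun h => (h.1, ordS h.2))) => -[c k].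
by rewrite /turn_fun /= ord_predK.
Qed.

Definition turn : {perm C * 'I_4} := perm turn_inj.

(* Walks along the boundary of a region, keeping it on the left: the corner
   [(c, k)] lies to the left of the half-strand [(c, k)] seen from [c]. *)
Definition boundary_perm : {perm C * 'I_4} := (opp * turn)%g.

Definition adjacent_crossings : rel C :=
  [rel c d | [exists k, (opp (c, k)).1 == d]].

End CombinatorialMap.

(* Oriented diagrams all of whose components have a crossing, as combinatorial
   maps of genus 0: [opp] exchanges the two ends of each segment, the regions
   are the orbits of [boundary_perm], and [planarP] is Euler's formula
   V - E + F = 2K for V crossings, E = 2V segments and K connected components
   (for a connected diagram, there are V + 2 regions). *)
Record link_diagram := LinkDiagram {
  crossing : finType;
  positive : pred crossing;
  opp : {perm crossing * 'I_4};
  oppK : involutive opp;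
  opp_incoming : forall h,
    incoming_at positive (opp h) = ~~ incoming_at positive h;
  planarP : #|porbits (boundary_perm opp)|
    = (#|crossing| + 2 * n_comp (adjacent_crossings opp) crossing)%N }.

Section LinkDiagram.
Variable L : link_diagram.

Definition half_strand : finType := (crossing L * 'I_4)%type.

Definition incoming (h : half_strand) : bool := incoming_at (@positive L) h.

Definition under (h : half_strand) : bool := ~~ odd h.2.

(* A segment is given by its initial half-strand. *)
Definition segment : finType := {h : half_strand | ~~ incoming h}.

Definition seg_start (j : segment) : half_strand := val j.
Definition seg_end (j : segment) : half_strand := opp L (val j).

Definition regions : {set {set half_strand}} := porbits (boundary_perm (opp L)).

Definition region_of (h : half_strand) : {set half_strand} :=
  porbit (boundary_perm (opp L)) h.

Definition left_region (j : segment) := region_of (seg_start j).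
Definition right_region (j : segment) := region_of (turn _ (seg_start j)).

Definition connected_diagram : Prop :=
  n_comp (adjacent_crossings (opp L)) (crossing L) = 1%N.

(* A simple closed curve meeting the diagram transversally in exactly two
   points, on the segments [j] and [k], runs through two regions, which are both
   the ones on the two sides of [j] and the ones on the two sides of [k].  [A] is
   the set of crossings inside it: the ends of a segment are on different sides
   iff the curve meets the segment an odd number of times. *)
Definition two_point_curve (j k : segment) (A : {set crossing L}) : Prop :=
  [set left_region j; right_region j] = [set left_region k; right_region k] /\
  forall s : segment,
    ((seg_start s).1 \in A) (+) ((seg_end s).1 \in A) = (s == j) (+) (s == k).

Definition prime_like : Prop :=
  ~ exists j k A, [/\ two_point_curve j k A, A != set0 & A != setT].

(* The curve leaves [c] through one corner and comes back to it through another
   one, staying in a single region. *)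
Definition nugatory (c : crossing L) : Prop :=
  exists k l : 'I_4, k != l /\ region_of (c, k) = region_of (c, l).

(* The face [f_j] containing the segment [j] from [c] to [d] has the vertices
   [c], the left region, [d], the right region, in clockwise order. *)
Definition face_crossing_graph :
    bip_plane_graph (crossing L) {set half_strand} segment :=
  {| white := regions;
     edges := [set e | [exists k : 'I_4, region_of (e.1, k) == e.2]];
     faces := setT;
     bw := fun j => [set ((seg_start j).1, left_region j);
                         ((seg_end j).1, right_region j)];
     wb := fun j => [set ((seg_end j).1, left_region j);
                         ((seg_start j).1, right_region j)] |}.

Definition absent_regions (i : segment) : {set {set half_strand}} :=
  [set left_region i; right_region i].

Definition present_regions (i : segment) : {set {set half_strand}} :=
  regions :\: absent_regions i.

Definition truncated_graph (i : segment) :=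
  delete_white face_crossing_graph (absent_regions i).

(** ** Laurent polynomials, inside the field of fractions of Z[t] *)

Definition t : {fraction {poly int}} := tofrac 'X.

Definition sim (P Q : {fraction {poly int}}) : Prop :=
  exists (s : bool) (k : int), P = (-1) ^+ s * t ^ k * Q.

Definition y_spec (j : segment) : {fraction {poly int}} :=
  if under (seg_start j) && ~~ under (seg_end j) then - t
  else if ~~ under (seg_start j) && under (seg_end j) then - t^-1
  else -1.

Definition specialized_dimer_poly (i : segment) : {fraction {poly int}} :=
  mmap intr (fun x => y_spec (enum_val x)) (dimer_face_poly (truncated_graph i)).

(** ** Kauffman states *)

(* A state records the corner of each crossing that contains its marker. *)
Definition kauffman_state (i : segment) (S : {ffun crossing L -> 'I_4}) : bool :=
  injectiveb (fun c => region_of (c, S c)) &&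
  ([set region_of (c, S c) | c : crossing L] == present_regions i).

Definition corner_weight (k : 'I_4) : {fraction {poly int}} :=
  tnth [tuple 1; -1; t; - t] k.

Definition bracket (S : {ffun crossing L -> 'I_4}) : {fraction {poly int}} :=
  \prod_(c : crossing L) corner_weight (S c).

Definition black_holes (S : {ffun crossing L -> 'I_4}) : nat :=
  #|[set c | incoming (c, S c) && incoming (c, ordS (S c))]|.

Definition state_matching (S : {ffun crossing L -> 'I_4}) :
    {set crossing L * {set half_strand}} :=
  [set (c, region_of (c, S c)) | c : crossing L].

Definition min_state (i : segment) : {ffun crossing L -> 'I_4} :=
  odflt [ffun=> ord0]
    [pick S | kauffman_state i S
              && (state_matching S == min_matching (truncated_graph i))].

(** ** The Alexander polynomial *)

(* Alexander's original definition (Topological invariants of knots and links,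
   1928): the matrix of the linear forms t r_1 - t r_2 + r_3 - r_4, where r_1,
   ..., r_4 are the regions met counterclockwise around a crossing, r_1 and r_2
   being to the left of the under-strand; the polynomial, defined up to
   multiplication by +-t^k, is the determinant that remains after deleting the
   columns of any two regions that share a segment. *)
Definition alexander_entry (c : crossing L) (r : {set half_strand}) :
    {fraction {poly int}} :=
  \sum_(k < 4 | region_of (c, k) == r) corner_weight k.

Definition alexander_det (j : segment) : {fraction {poly int}} :=
  \det (\matrix_(a < #|crossing L|, b < #|crossing L|)
          alexander_entry (enum_val a) (nth set0 (enum (present_regions j)) b)).

Definition alexander_polynomial (P : {fraction {poly int}}) : Prop :=
  exists j : segment, sim P (alexander_det j).

End LinkDiagram.

(* Main.v *)
(** Kauffman states are the perfect matchings of [G_{L,i}], and a down-flip at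
    [f_j] moves the markers at both ends of [j] clockwise across [j].  Such a move
    divides the signed weight [(-1)^b(S) <L|S>] by exactly the specialized [y_j], so
    the first identity telescopes as soon as every matching can be brought to one
    and the same matching by down-flips.

    Euler's formula and two rank estimates show that the complex segments ->
    corners -> crossings and regions is exact; hence two states differ by a height
    function on segments, and a state [S] of minimal total height exists.  If some
    [S'] is higher than [S] somewhere, then [S'] has a down-flip: otherwise one could
    walk among the highest segments counterclockwise around unmarked corners,
    and the resulting dual cycle would bound a proper set [Y] of crossings that
    contains at least [#|Y|] regions.  But cycle ranks give fewer than [#|Y|]
    regions inside [Y], because by primeness at least four segments leave each
    piece of [Y].

    A flip is a transposition in the determinant expansion and changes the parity
    of the number of black holes, so the state sum is, up to sign, the Alexander
    determinant.  Alexander's numbering [p] of the regions gives the two column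
    relations with coefficients [1] and [t^-p], and comparing complementary minors
    shows that the determinant does not depend, up to [+-t^k], on the segment whose
    regions are deleted. *)

From mathcomp Require Import all_boot all_order all_fingroup all_algebra.
From mathcomp Require Import fraction zify ring.
Require Import Defs.

Set Implicit Arguments.
Unset Strict Implicit.
Unset Printing Implicit Defensive.

Import Order.TTheory GRing.Theory Num.Theory.
Local Open Scope ring_scope.

(** * Exactness from dimension counts *)

Section FinMatrix.
Variable F : fieldType.

Definition fun_mx (A B : finType) (P : A -> B -> F) : 'M[F]_(#|A|, #|B|) :=
  \matrix_(i, j) P (enum_val i) (enum_val j).

Definition fun_row (A : finType) (u : A -> F) : 'rV[F]_#|A| :=
  \row_i u (enum_val i).

Lemma sum_enum_val (A : finType) (f : A -> F) :
  \sum_(i < #|A|) f (enum_val i) = \sum_a f a.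
Proof. by rewrite -(big_enum_val (A := predT) f). Qed.

Lemma fun_row_mul (A B : finType) (P : A -> B -> F) (u : A -> F) :
  fun_row u *m fun_mx P = fun_row (fun b => \sum_a u a * P a b).
Proof.
apply/rowP => j; rewrite !mxE -(sum_enum_val (fun a => u a * P a _)).
by apply: eq_bigr => k _; rewrite !mxE.
Qed.

Lemma fun_row_enum_rank (A : finType) (v : 'rV[F]_#|A|) :
  v = fun_row (fun a => v 0 (enum_rank a)).
Proof. by apply/rowP => j; rewrite !mxE enum_valK. Qed.

Lemma fun_row_inj (A : finType) (u v : A -> F) : fun_row u = fun_row v -> u =1 v.
Proof. by move=> /rowP uv a; have := uv (enum_rank a); rewrite !mxE enum_rankK. Qed.

Lemma fun_mx_mul (A B E : finType) (P : A -> B -> F) (Q : B -> E -> F) :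
  fun_mx P *m fun_mx Q = fun_mx (fun a e => \sum_b P a b * Q b e).
Proof.
apply/matrixP => i j; rewrite !mxE -(sum_enum_val (fun b => P _ b * Q b _)).
by apply: eq_bigr => k _; rewrite !mxE.
Qed.

Lemma fun_mx_tr (A B : finType) (P : A -> B -> F) :
  (fun_mx P)^T = fun_mx (fun b a => P a b).
Proof. by apply/matrixP => i j; rewrite !mxE. Qed.

Lemma rank_fun_mx_free (A B : finType) (P : A -> B -> F) :
  (forall u : A -> F, (forall b, \sum_a u a * P a b = 0) -> forall a, u a = 0) ->
  \rank (fun_mx P) = #|A|.
Proof.
move=> kerP; apply/eqP.
change (row_free (fun_mx P)); rewrite -kermx_eq0.
apply/negPn/negP => /rowV0Pn [v /sub_kermxP vP /eqP]; apply.
rewrite (fun_row_enum_rank v) fun_row_mul in vP.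
apply/rowP => i; rewrite -[i]enum_valK mxE.
apply: (kerP (fun a => v 0 (enum_rank a))) => b.
by have /rowP/(_ (enum_rank b)) := vP; rewrite !mxE enum_rankK.
Qed.

(** The left kernel lies in the line of constant functions, so it has dimension at most one. *)
Lemma rank_fun_mx_const (A B : finType) (P : A -> B -> F) :
  (forall u : A -> F, (forall b, \sum_a u a * P a b = 0) -> forall a a', u a = u a') ->
  (#|A| <= (\rank (fun_mx P)).+1)%N.
Proof.
move=> kerP; rewrite -addn1 -leq_subLR -mxrank_ker.
suff : (kermx (fun_mx P) <= fun_row (fun _ : A => 1))%MS.
  by move=> /mxrankS/leq_trans; apply; apply: rank_leq_row.
apply/row_subP => i; move: (row i _) (row_sub i (kermx (fun_mx P))) => v /sub_kermxP.
rewrite (fun_row_enum_rank v) fun_row_mul => vP.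
(* For empty [A] there is no point at which to read off the constant, but then the row is zero. *)
case: (pickP A) => [a0 _|A0]; last first.
  suff -> : fun_row (fun a => v 0 (enum_rank a)) = 0 by apply: sub0mx.
  by apply/rowP => j; have := A0 (enum_val j).
apply/sub_rVP; exists (v 0 (enum_rank a0)); apply/rowP => j; rewrite !mxE mulr1.
apply: (kerP (fun a => v 0 (enum_rank a))) => b.
by have /rowP/(_ (enum_rank b)) := vP; rewrite !mxE enum_rankK.
Qed.

(** The rank of [P] is [#|A|], that of [Q] is at least [#|E| - 1], and a zero product bounds their
    sum by [#|B|]. *)
Lemma complex_card_le (A B E : finType) (P : A -> B -> F) (Q : B -> E -> F) :
  (forall a e, \sum_b P a b * Q b e = 0) ->
  (forall u : A -> F, (forall b, \sum_a u a * P a b = 0) -> forall a, u a = 0) ->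
  (forall v : E -> F, (forall b, \sum_e v e * Q b e = 0) -> forall e e', v e = v e') ->
  (#|A| + #|E| <= #|B| + 1)%N.
Proof.
move=> PQ0 kerP kerQ.
have rP := rank_fun_mx_free kerP.
have rQ := @rank_fun_mx_const _ _ (fun e b => Q b e) kerQ.
rewrite -fun_mx_tr mxrank_tr in rQ.
have /mulmx0_rank_max : fun_mx P *m fun_mx Q = 0.
  by rewrite fun_mx_mul; apply/matrixP => i j; rewrite !mxE.
rewrite rP => le_B; rewrite addn1 (leq_trans _ (_ : #|A| + (\rank (fun_mx Q)).+1 <= _)%N) //.
  by rewrite leq_add2l.
by rewrite addnS ltnS.
Qed.

(** The row space of [P] lies in the left kernel of [Q]. The latter has dimension at most
    [#|B| - #|E| + 1 <= #|A| - 1], which is at most the rank of [P], so the two coincide. *)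
Lemma complex_exact (A B E : finType) (P : A -> B -> F) (Q : B -> E -> F) :
  (forall a e, \sum_b P a b * Q b e = 0) ->
  (forall u : A -> F, (forall b, \sum_a u a * P a b = 0) -> forall a a', u a = u a') ->
  (forall v : E -> F, (forall b, \sum_e v e * Q b e = 0) -> forall e e', v e = v e') ->
  (#|B| + 2 <= #|A| + #|E|)%N ->
  forall x : B -> F, (forall e, \sum_b x b * Q b e = 0) ->
  exists u : A -> F, forall b, x b = \sum_a u a * P a b.
Proof.
move=> PQ0 kerP kerQ cardBAE x xQ0.
have rP := rank_fun_mx_const kerP.
have rQ := @rank_fun_mx_const _ _ (fun e b => Q b e) kerQ.
rewrite -fun_mx_tr mxrank_tr in rQ.
have PQ : fun_mx P *m fun_mx Q = 0.
  by rewrite fun_mx_mul; apply/matrixP => i j; rewrite !mxE.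
have sub_ker : (fun_mx P <= kermx (fun_mx Q))%MS by apply/sub_kermxP.
have ker_sub : (kermx (fun_mx Q) <= fun_mx P)%MS.
  rewrite -(geq_leqif (mxrank_leqif_sup sub_ker)) mxrank_ker leq_subLR.
  have := leq_trans cardBAE (leq_add rP rQ).
  by rewrite addn2 addSn addnS !ltnS [leqRHS]addnC.
have xk : (fun_row x <= kermx (fun_mx Q))%MS.
  apply/sub_kermxP; rewrite fun_row_mul; apply/rowP => j.
  by rewrite !mxE.
have /submxP [D] := submx_trans xk ker_sub.
rewrite (fun_row_enum_rank D) fun_row_mul => /fun_row_inj xE.
by exists (fun a => D 0 (enum_rank a)) => b; rewrite xE.
Qed.

End FinMatrix.

(** * Half-strands, segments and regions *)

Lemma n_comp1_connect (T : finType) (e : rel T) :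
  symmetric e -> n_comp e T = 1%N -> forall x y, connect e x y.
Proof.
move=> /sym_connect_sym e_sym; rewrite /n_comp_mem => /mem_card1 [z /= rz] x y.
have rootz u : fingraph.root e u = z.
  by apply/eqP; have := rz (fingraph.root e u); rewrite !inE roots_root // => <-.
by rewrite -(root_connect e_sym) !rootz.
Qed.

Section Diagram.
Variable L : link_diagram.
Local Notation H := (half_strand L).
Local Notation C := (crossing L).
Local Notation turn := (turn C).
Local Notation bd := (boundary_perm (opp L)).

Definition ccw (h : H) : H := (h.1, ordS h.2).

Lemma turnE (h : H) : turn h = (h.1, ord_pred h.2).
Proof. by rewrite permE. Qed.

Lemma turnK : cancel turn ccw.
Proof. by case=> c k; rewrite turnE /ccw /= ord_predK. Qed.

Lemma ccwK : cancel ccw turn.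
Proof. by case=> c k; rewrite turnE /ccw /= ordSK. Qed.

Lemma bdE (h : H) : bd h = turn (opp L h).
Proof. by rewrite permM. Qed.

Lemma bd_crossing (h : H) : (bd h).1 = (opp L h).1.
Proof. by rewrite bdE turnE. Qed.

Lemma region_ofP (h h' : H) :
  reflect (region_of h = region_of h') (h' \in region_of h).
Proof.
by rewrite /region_of porbit_sym -eq_porbit_mem; apply: eqP.
Qed.

Lemma mem_region_of (h : H) : h \in region_of h.
Proof. exact: porbit_id. Qed.

Lemma region_of_regions (h : H) : region_of h \in regions L.
Proof. exact: imset_f. Qed.

Lemma regionsP (r : {set H}) :
  reflect (exists h, r = region_of h) (r \in regions L).
Proof. by apply: (iffP imsetP) => [[h _ ->]|[h ->]]; exists h. Qed.

Lemma region_bd (h : H) : region_of (bd h) = region_of h.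
Proof. by apply/esym/region_ofP; apply: (mem_porbit _ 1). Qed.

Lemma region_turn_opp (h : H) : region_of (turn (opp L h)) = region_of h.
Proof. by rewrite -bdE region_bd. Qed.

Lemma region_opp (h : H) : region_of (opp L h) = region_of (turn h).
Proof. by rewrite -[X in turn X](oppK h) region_turn_opp. Qed.

Lemma mem_region_bd (r : {set H}) (h : H) :
  r \in regions L -> (bd h \in r) = (h \in r).
Proof.
by case/regionsP => g ->; apply/region_ofP/region_ofP; rewrite region_bd.
Qed.

Lemma mem_regionE (r : {set H}) (h : H) :
  r \in regions L -> (h \in r) = (region_of h == r).
Proof.
by case/regionsP => g ->; apply/region_ofP/eqP.
Qed.

Lemma region_const (T : Type) (f : H -> T) (h : H) :
  (forall g, g \in region_of h -> f (bd g) = f g) ->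
  forall g, g \in region_of h -> f g = f h.
Proof.
move=> fbd g /porbitP [n ->]; elim: n => [|n IHn]; first by rewrite perm1.
by rewrite expgSr permM fbd // mem_porbit.
Qed.

Lemma sum_region_bd (V : nmodType) (r : {set H}) (f : H -> V) :
  r \in regions L -> \sum_(h in r) f (bd h) = \sum_(h in r) f h.
Proof.
move=> rR; rewrite [RHS](reindex_inj (@perm_inj _ bd)) /=.
by apply: eq_bigl => h; rewrite mem_region_bd.
Qed.

Lemma seg_of_subproof (h : H) : ~~ incoming (if incoming h then opp L h else h).
Proof.
case: ifP => [|->//]; rewrite /incoming (opp_incoming h).
by move=> ->.
Qed.

Definition seg_of (h : H) : segment L :=
  exist (fun g => ~~ incoming g) _ (seg_of_subproof h).

Lemma incoming_opp (h : H) : incoming (opp L h) = ~~ incoming h.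
Proof. exact: opp_incoming. Qed.

Lemma incoming_start (j : segment L) : incoming (seg_start j) = false.
Proof. by case: j => h hP; apply: negbTE. Qed.

Lemma incoming_end (j : segment L) : incoming (seg_end j) = true.
Proof. by rewrite incoming_opp -/(seg_start j) incoming_start. Qed.

Lemma seg_of_opp (h : H) : seg_of (opp L h) = seg_of h.
Proof.
by apply: val_inj => /=; rewrite incoming_opp; case: (incoming h); rewrite //= oppK.
Qed.

Lemma seg_of_start (j : segment L) : seg_of (seg_start j) = j.
Proof. by apply: val_inj; rewrite /= incoming_start. Qed.

Lemma seg_of_end (j : segment L) : seg_of (seg_end j) = j.
Proof. by rewrite /seg_end seg_of_opp seg_of_start. Qed.

Lemma seg_of_eq (h : H) (j : segment L) :
  (seg_of h == j) = (h == seg_start j) || (h == seg_end j).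
Proof.
apply/eqP/orP => [<-|[] /eqP ->]; rewrite ?seg_of_start ?seg_of_end //.
by rewrite /seg_end /seg_start /=; case: ifP; rewrite ?oppK eqxx; [right|left].
Qed.

(** Shaped as an elimination principle: [elim/half_strand_ends] replaces a half-strand by the start
    or the end of a segment. *)
Lemma half_strand_ends (P : H -> Prop) :
  (forall s : segment L, P (seg_start s)) -> (forall s : segment L, P (seg_end s)) ->
  forall h, P h.
Proof.
by move=> Ps Pe h; have := eqxx (seg_of h); rewrite seg_of_eq => /orP [] /eqP ->.
Qed.

Lemma opp_seg_end (j : segment L) : opp L (seg_end j) = seg_start j.
Proof. exact: oppK. Qed.

Lemma start_neq_end (j : segment L) : seg_start j != seg_end j.
Proof. by apply/eqP => e; have := incoming_start j; rewrite e incoming_end. Qed.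

Lemma sum_ends (V : nmodType) (f : H -> V) (j : segment L) :
  \sum_(h | seg_of h == j) f h = f (seg_start j) + f (seg_end j).
Proof.
rewrite (bigD1 (seg_start j)) ?seg_of_start //= (bigD1 (seg_end j)) /=.
  rewrite big1 ?addr0 // => h; rewrite seg_of_eq.
  by case: eqP => //= _; case: eqP.
by rewrite seg_of_end eqxx eq_sym start_neq_end.
Qed.

Lemma sum_half_strands (V : nmodType) (f : H -> V) :
  \sum_h f h = \sum_(j : segment L) (f (seg_start j) + f (seg_end j)).
Proof.
by rewrite (partition_big seg_of xpredT) //; apply: eq_bigr => j _; apply: sum_ends.
Qed.

Lemma card_segment : #|segment L| = (2 * #|C|)%N.
Proof.
have : \sum_(h : H) (1 : nat) = \sum_(j : segment L) ((1 : nat) + 1) by apply: sum_half_strands.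
rewrite !sum_nat_const card_prod card_ord !muln1 => e.
by apply/eqP; rewrite -(eqn_pmul2r (isT : 0 < 2)%N) -e mulnAC mulnC.
Qed.

Lemma left_regionE (j : segment L) : left_region j = region_of (seg_start j).
Proof. by []. Qed.

Lemma right_regionE (j : segment L) : right_region j = region_of (seg_end j).
Proof. by rewrite /right_region /seg_end region_opp. Qed.

Lemma adjacent_sym : symmetric (adjacent_crossings (opp L)).
Proof.
suff imp c d : adjacent_crossings (opp L) c d -> adjacent_crossings (opp L) d c.
  by move=> c d; apply/idP/idP; apply: imp.
move=> /existsP [k /eqP <-]; apply/existsP; exists (opp L (c, k)).2.
by rewrite -surjective_pairing oppK.
Qed.

Lemma card_regions : connected_diagram L -> #|regions L| = (#|C| + 2)%N.
Proof. by move=> Lc; rewrite /regions (planarP L) Lc muln1. Qed.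

Lemma crossing_const (T : eqType) (f : C -> T) : connected_diagram L ->
  (forall h : H, f h.1 = f (opp L h).1) -> forall c d, f c = f d.
Proof.
move=> Lc fopp c d.
have /connectP [p] := n_comp1_connect adjacent_sym Lc c d.
elim: p c => [|a p IHp] c /=; first by move=> _ ->.
by move=> /andP [/existsP [k /eqP <-]] pth dE; rewrite (fopp (c, k)); apply: IHp.
Qed.

(** Rotation at crossings and passage to the other end of a segment act transitively on the
    half-strands of a connected diagram. *)
Lemma half_strand_const (T : eqType) (f : H -> T) : connected_diagram L ->
  (forall h, f (ccw h) = f h) -> (forall h, f (opp L h) = f h) ->
  forall h h', f h = f h'.
Proof.
move=> Lc fccw fopp.
have ford c (k : 'I_4) : f (c, k) = f (c, ord0).
  have fS (m : nat) (lt_m : (m.+1 < 4)%N) : f (c, Ordinal lt_m) = f (c, Ordinal (ltnW lt_m)).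
    rewrite -(fccw (c, Ordinal (ltnW _))); congr (f (_, _)); apply: val_inj.
    by rewrite /= modn_small.
  case: k => m; elim: m => [|m IHm] lt_m; first by congr (f (_, _)); apply: val_inj.
  by rewrite fS IHm.
have g_const := @crossing_const T (fun c => f (c, ord0)) Lc.
move=> [c k] [d l]; rewrite !ford; apply: g_const => -[a m].
by rewrite /= -(ford a m) -(fopp (a, m)) [opp L (a, m)]surjective_pairing ford.
Qed.

End Diagram.

(** * The two exact sequences of the face-crossing graph *)

Lemma sum_indicator (R : pzSemiRingType) (A : finType) (b : pred A) (u : A -> R) :
  \sum_a u a * (b a)%:R = \sum_(a | b a) u a.
Proof.
rewrite [RHS]big_mkcond; apply: eq_bigr => a _.
by case: (b a); rewrite ?mulr1 ?mulr0.
Qed.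

Lemma sum_delta (R : pzSemiRingType) (A : finType) (u : A -> R) (x : A) :
  \sum_a u a * (x == a)%:R = u x.
Proof. by rewrite sum_indicator (big_pred1 x) // => a; rewrite eq_sym. Qed.

Section Exactness.
Variable L : link_diagram.
Hypothesis L_connected : connected_diagram L.
Local Notation H := (half_strand L).
Local Notation C := (crossing L).
Local Notation turn := (turn C).
Local Notation bd := (boundary_perm (opp L)).

Definition region_type : finType := {r : {set H} | r \in regions L}.

Lemma card_region_type : #|region_type| = (#|C| + 2)%N.
Proof. by rewrite card_sig card_regions. Qed.

Let region (h : H) : region_type :=
  exist (fun r => r \in regions L) _ (region_of_regions h).

(** The face-crossing graph cuts the sphere into cells: segments are the faces, corners the edges,
    crossings and regions the vertices. [cobound] and [bound] are the face-edge and edge-vertex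
    incidence coefficients of this cell structure. *)
Let cobound (s : segment L) (h : H) : rat :=
  (seg_of (ccw h) == s)%:R - (seg_of h == s)%:R.

Let bound (h : H) (v : C + region_type) : rat :=
  match v with inl c => (h.1 == c)%:R | inr r => - (region h == r)%:R end.

Let sum_cobound (u : segment L -> rat) h :
  \sum_s u s * cobound s h = u (seg_of (ccw h)) - u (seg_of h).
Proof.
rewrite -(sum_delta u) -(sum_delta u (seg_of h)) -sumrB.
by apply: eq_bigr => s _; rewrite mulrBr.
Qed.

Let sum_bound (u : C + region_type -> rat) h :
  \sum_v u v * bound h v = u (inl h.1) - u (inr (region h)).
Proof.
rewrite big_sumType /= (sum_delta (u \o inl)); congr (_ + _).
under eq_bigr do rewrite mulrN.
by rewrite sumrN (sum_delta (u \o inr)).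
Qed.

Let sum_ccw (f : H -> rat) (g : H -> rat) :
  \sum_h f (ccw h) * g h = \sum_h f h * g (turn h).
Proof.
rewrite [RHS](reindex_inj (can_inj (@ccwK L))) /=.
by apply: eq_bigr => h _; rewrite ccwK.
Qed.

Let region_bd' (h : H) : region (bd h) = region h.
Proof. by apply: val_inj; rewrite /= region_bd. Qed.

(** The two halves of [cobound] cancel after reindexing, by [ccw] around a crossing and by [bd]
    around a region. *)
Let complex0 s v : \sum_h cobound s h * bound h v = 0.
Proof.
pose f h : rat := (seg_of h == s)%:R.
rewrite (eq_bigr (fun h => f (ccw h) * bound h v - f h * bound h v)); last first.
  by move=> h _; rewrite mulrBl.
rewrite sumrB; apply/eqP; rewrite subr_eq0; apply/eqP; case: v => [c|r] /=.
  by rewrite sum_ccw; apply: eq_bigr => h _; rewrite turnE.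
rewrite (reindex_inj (@perm_inj _ bd)) /=; apply: eq_bigr => h _.
by rewrite region_bd' bdE turnK /f seg_of_opp.
Qed.

Let cobound_ker u : (forall h, \sum_s u s * cobound s h = 0) -> forall s s', u s = u s'.
Proof.
move=> u0 s s'; rewrite -(seg_of_start s) -(seg_of_start s').
apply: (half_strand_const (f := u \o @seg_of L)) => // h /=.
  by apply/eqP; rewrite -subr_eq0 -sum_cobound u0.
by rewrite seg_of_opp.
Qed.

Let bound_ker u : (forall h, \sum_v u v * bound h v = 0) -> forall v v', u v = u v'.
Proof.
move=> u0.
have uE h : u (inl h.1) = u (inr (region h)).
  by apply/eqP; rewrite -subr_eq0 -sum_bound u0.
have uC c d : u (inl c) = u (inl d).
  apply: (crossing_const (f := u \o inl)) => // h /=.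
  by rewrite uE -region_bd' -uE bd_crossing.
have uR (r : region_type) : exists c, u (inr r) = u (inl c).
  case: (regionsP _ (valP r)) => h rE; exists h.1; rewrite uE; congr (u (inr _)).
  exact: val_inj.
have uV v : exists c, u v = u (inl c) by case: v => [c|r] //; exists c.
by move=> v v'; case: (uV v) (uV v') => [c ->] [d ->].
Qed.

(** The Euler characteristic of the sphere is 2; this is where planarity enters. *)
Let card_complex : (#|H| + 2 = #|segment L| + #|{: C + region_type}|)%N.
Proof.
rewrite card_segment card_sum card_region_type card_prod card_ord mulnC.
by rewrite !mulSn !mul0n !addn0 !addnA.
Qed.

(** A cycle, having zero sum at every vertex, is a boundary. It will be applied to the difference of
    the markers of two states. *)
Lemma height_exists (x : H -> rat) :
  (forall c, \sum_(h | h.1 == c) x h = 0) ->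
  (forall r, r \in regions L -> \sum_(h in r) x h = 0) ->
  exists D : segment L -> rat, forall h, x h = D (seg_of (ccw h)) - D (seg_of h).
Proof.
move=> xC xR.
have xv v : \sum_h x h * bound h v = 0.
  case: v => [c|r] /=; first by rewrite (sum_indicator (fun h : H => h.1 == c)) xC.
  under eq_bigr do rewrite mulrN.
  rewrite sumrN (sum_indicator (fun h => region h == r)).
  apply/eqP; rewrite oppr_eq0 -[eqbRHS](xR _ (valP r)); apply/eqP.
  by apply: eq_bigl => h; rewrite mem_regionE ?(valP r).
have cardH := eq_leq card_complex.
have [u xE] := complex_exact complex0 cobound_ker bound_ker cardH xv.
by exists u => h; rewrite xE sum_cobound.
Qed.

(** The dual statement: a cochain that is closed around every segment is a difference of vertex
    potentials. The transposed complex satisfies the same numerical condition. *)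
Lemma potential_exists (x : H -> rat) :
  (forall h, x h + x (opp L h) = x (turn h) + x (turn (opp L h))) ->
  exists (phi : C -> rat) (psi : {set H} -> rat),
    forall h, x h = phi h.1 - psi (region_of h).
Proof.
move=> xE; pose P v h := bound h v; pose Q h s := cobound s h.
have PQ0 v s : \sum_h P v h * Q h s = 0.
  by apply: etrans (complex0 s v); apply: eq_bigr => h _; apply: mulrC.
have xs s : \sum_h x h * Q h s = 0.
  rewrite /Q /cobound; under eq_bigr do rewrite mulrBr.
  rewrite sumrB (sum_indicator (fun h => seg_of h == s)) sum_ends xE.
  under eq_bigr do rewrite mulrC.
  rewrite (sum_ccw (fun h => (seg_of h == s)%:R)).
  under eq_bigr do rewrite mulrC.
  by rewrite (sum_indicator (fun h => seg_of h == s)) sum_ends subrr.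
have cardH := eq_leq (etrans card_complex (addnC _ _)).
have [u uE] := complex_exact PQ0 bound_ker cobound_ker cardH xs.
(* The value 0 outside the regions is only a filler: [psi] is read at [region_of h]. *)
exists (u \o inl), (fun r => if insub r is Some r' then u (inr r') else 0) => h.
rewrite uE sum_bound /=; congr (_ - _).
case: insubP => [r _ rE|]; last by rewrite region_of_regions.
by congr (u (inr _)); apply: val_inj.
Qed.

End Exactness.

Lemma complex_card_le_in (F : fieldType) (TA TB TE : finType)
    (A : {set TA}) (B : {set TB}) (E : {set TE}) (P : TA -> TB -> F) (Q : TB -> TE -> F) :
  (forall a e, a \in A -> e \in E -> \sum_(b in B) P a b * Q b e = 0) ->
  (forall u : TA -> F, (forall b, b \in B -> \sum_(a in A) u a * P a b = 0) ->
     forall a, a \in A -> u a = 0) ->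
  (forall v : TE -> F, (forall b, b \in B -> \sum_(e in E) v e * Q b e = 0) ->
     forall e e', e \in E -> e' \in E -> v e = v e') ->
  (#|A| + #|E| <= #|B| + 1)%N.
Proof.
move=> PQ0 kerP kerQ.
pose ext (T : finType) (D : {set T}) (u : {x in D} -> F) (x : T) : F :=
  if insub x is Some y then u y else 0.
have extE (T : finType) (D : {set T}) u (x : {x in D}) : @ext T D u (val x) = u x by rewrite /ext valK.
have := @complex_card_le F {x in A} {x in B} {x in E}
  (fun a b => P (val a) (val b)) (fun b e => Q (val b) (val e)).
rewrite !card_sig; apply.
- move=> a e; rewrite -[RHS](PQ0 (val a) (val e)) ?(valP a) ?(valP e) //.
  by rewrite [RHS]big_sub.
- move=> u u0 a; rewrite -extE; apply: kerP (valP a) => b bB.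
  rewrite big_sub -[RHS](u0 (exist _ b bB)).
  by apply: eq_bigr => x _; rewrite extE.
move=> v v0 e e'; rewrite -!extE; apply: kerQ (valP e) (valP e') => b bB.
rewrite big_sub -[RHS](v0 (exist _ b bB)).
by apply: eq_bigr => x _; rewrite extE.
Qed.

(** * Regions inside a set of crossings *)

Section InnerRegions.
Variable L : link_diagram.
Hypothesis L_connected : connected_diagram L.
Local Notation H := (half_strand L).
Local Notation C := (crossing L).
Local Notation bd := (boundary_perm (opp L)).

Definition inner_regions (Y : {set C}) : {set {set H}} :=
  [set r in regions L | [forall h in r, h.1 \in Y]].

Definition inner_segments (Y : {set C}) : {set segment L} :=
  [set s | ((seg_start s).1 \in Y) && ((seg_end s).1 \in Y)].

Definition exiting_segments (Y : {set C}) : {set segment L} :=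
  [set s | ((seg_start s).1 \in Y) && ((seg_end s).1 \notin Y)].

Definition entering_segments (Y : {set C}) : {set segment L} :=
  [set s | ((seg_start s).1 \notin Y) && ((seg_end s).1 \in Y)].

(** Connectedness of the graph formed by [K] and its inner segments, stated through cuts so that its
    failure directly yields a splitting of [K]. *)
Definition indecomposable (K : {set C}) : Prop :=
  forall A : {set C}, A \subset K -> A != set0 -> A != K ->
  exists2 s, s \in inner_segments K & ((seg_start s).1 \in A) != ((seg_end s).1 \in A).

Lemma inner_regionsP (Y : {set C}) (h : H) :
  reflect (forall h', h' \in region_of h -> h'.1 \in Y) (region_of h \in inner_regions Y).
Proof. by rewrite inE region_of_regions; apply: forall_inP. Qed.

Lemma inner_region_opp (Y : {set C}) (h : H) :
  region_of h \in inner_regions Y -> (h.1 \in Y) && ((opp L h).1 \in Y).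
Proof.
move=> /inner_regionsP rY; rewrite -bd_crossing !rY ?mem_region_of //.
by apply/region_ofP; rewrite region_bd.
Qed.

(** The boundaries of the inner regions are independent cycles of the graph of inner segments, so
    there are at most as many of them as the cycle rank of that connected graph. *)
Lemma inner_regions_connected_le (K : {set C}) : K != setT -> indecomposable K ->
  (#|inner_regions K| + #|K| <= #|inner_segments K| + 1)%N.
Proof.
move=> KT K_ind.
pose P (r : {set H}) (s : segment L) : rat := (seg_start s \in r)%:R - (seg_end s \in r)%:R.
pose Q (s : segment L) (c : C) : rat := ((seg_start s).1 == c)%:R - ((seg_end s).1 == c)%:R.
apply: (@complex_card_le_in rat _ _ _ _ _ _ P Q).
- move=> r c rK cK; have rR : r \in regions L by move: rK; rewrite inE => /andP [].
  have PE s : s \notin inner_segments K -> P r s = 0.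
    rewrite inE /P; apply: contraNeq; rewrite !mem_regionE //.
    case: (region_of (seg_start s) =P r) => [rE _|_].
      by have := @inner_region_opp K (seg_start s); rewrite rE => /(_ rK).
    case: (region_of (seg_end s) =P r) => [rE _|_]; last by rewrite subrr eqxx.
    by have := @inner_region_opp K (seg_end s); rewrite rE opp_seg_end andbC => /(_ rK).
  (* An inner region borders only inner segments, so the sum may run over its whole boundary, where
     it telescopes along [bd]. *)
  rewrite [LHS](_ : _ = \sum_s P r s * Q s c); last first.
    by rewrite [RHS](bigID (mem (inner_segments K))) /= [X in _ + X]big1 ?addr0 // => s /PE ->; rewrite mul0r.
  pose g (h : H) : rat := (h.1 == c)%:R.
  transitivity (\sum_h (h \in r)%:R * (g h - g (opp L h))).
    rewrite sum_half_strands; apply: eq_bigr => s _.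
    by rewrite /P /Q opp_seg_end -/(seg_end s) -/(g _) -/(g _) -[g (seg_end s) - _]opprB mulrN mulrBl.
  under eq_bigr do rewrite mulrC; rewrite (sum_indicator (mem r)) /= sumrB.
  apply/eqP; rewrite subr_eq0 -(sum_region_bd g rR); apply/eqP.
  by apply: eq_bigr => h _; rewrite /g bd_crossing.
(* Extended by zero, a relation takes equal values on the two sides of every segment, so it is
   constant. It vanishes at a region touching a crossing outside [K]. *)
- move=> u u0 r rK; pose v r := if r \in inner_regions K then u r else 0.
  have v_const : forall h h', v (region_of h) = v (region_of h').
    have vs s : v (region_of (seg_start s)) = v (region_of (seg_end s)).
      have [sK|sK] := boolP (s \in inner_segments K); last first.
        rewrite /v !ifN //; apply: contra sK => /inner_region_opp; rewrite inE //.
        by rewrite opp_seg_end andbC.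
      have := u0 s sK; rewrite /P; under eq_bigr do rewrite mulrBr.
      rewrite sumrB => /eqP; rewrite subr_eq0 => /eqP.
      have vE h' : \sum_(a in inner_regions K) u a * (h' \in a)%:R = v (region_of h').
        rewrite -(sum_delta v) [LHS]big_mkcond /=; apply: eq_bigr => a _.
        rewrite /v; case: ifP => aK; rewrite ?mul0r // mem_regionE //.
        by move: aK; rewrite inE => /andP [].
      by rewrite !vE.
    have vopp h : v (region_of (opp L h)) = v (region_of h).
      by elim/half_strand_ends: h => s; rewrite ?opp_seg_end ?vs.
    apply: (half_strand_const L_connected) => h //.
    by rewrite -vopp region_opp ccwK.
  have [c cK] : exists c, c \notin K.
    by apply/existsP; apply: contraNT KT => /existsPn cK; apply/eqP/setP => c; rewrite inE; apply/negPn.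
  have rR : r \in regions L by move: rK; rewrite inE => /andP [].
  have [h rE] := regionsP _ rR.
  have -> : u r = v r by rewrite /v rK.
  rewrite rE (v_const h (c, ord0)) /v ifN //.
  by apply: contra cK => /inner_region_opp /andP [].
move=> v v0 c d cK dK.
have vs s : s \in inner_segments K -> v (seg_start s).1 = v (seg_end s).1.
  move=> sK; have := v0 s sK; rewrite /Q; under eq_bigr do rewrite mulrBr.
  rewrite sumrB => /eqP; rewrite subr_eq0 => /eqP.
  have vE e : e \in K -> \sum_(a in K) v a * (e == a)%:R = v e.
    move=> eK; rewrite (bigD1 e) //= eqxx mulr1 big1 ?addr0 // => a /andP [_].
    by rewrite eq_sym => /negbTE ->; rewrite mulr0.
  by move: sK; rewrite inE => /andP [sK eK]; rewrite !vE.
pose A := [set e in K | v e == v c].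
have [AK|AK] := eqVneq A K; first by move: dK; rewrite -AK inE => /andP [_ /eqP].
have A0 : A != set0 by apply/set0Pn; exists c; rewrite inE cK eqxx.
have AsK : A \subset K by apply/subsetP => e; rewrite inE => /andP [].
have [s sK] := K_ind A AsK A0 AK.
by move: (sK); rewrite inE => /andP [sK1 sK2]; rewrite !inE sK1 sK2 (vs s sK) eqxx.
Qed.

Lemma card_incoming_at (b : bool) (c : C) : #|[pred k | incoming ((c, k) : H) == b]| = 2%N.
Proof.
rewrite -sum1_card big_mkcond /= !big_ord_recl big_ord0 !inE /incoming /incoming_at /=.
by case: (positive c); case: b.
Qed.

Lemma card_half_strands_in (b : bool) (Y : {set C}) :
  #|[set h : H | (h.1 \in Y) && (incoming h == b)]| = (2 * #|Y|)%N.
Proof.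
rewrite -sum1_card (eq_bigl (fun h : H => (h.1 \in Y) && (incoming (h.1, h.2) == b))).
  rewrite -(pair_big_dep (mem Y) (fun c k => incoming ((c, k) : H) == b) (fun _ _ => 1%N)) /=.
  under eq_bigr do rewrite (sum1_card (fun k => incoming (_, k) == b)) card_incoming_at.
  by rewrite sum_nat_const mulnC.
by move=> [c k]; rewrite !inE.
Qed.

Lemma seg_start_inj : injective (@seg_start L).
Proof. exact: val_inj. Qed.

Lemma seg_end_inj : injective (@seg_end L).
Proof. by move=> j k /perm_inj/val_inj. Qed.

Lemma card_starts_in (Y : {set C}) : #|[set s : segment L | (seg_start s).1 \in Y]| = (2 * #|Y|)%N.
Proof.
rewrite -(card_half_strands_in false) -(card_imset _ seg_start_inj); congr #|pred_of_set _|.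
apply/setP => h; rewrite !inE; apply/imsetP/andP => [[s sY ->]|].
  by rewrite incoming_start; move: sY; rewrite inE.
elim/half_strand_ends: h => s [sY]; last by rewrite incoming_end.
by exists s; rewrite ?inE.
Qed.

Lemma card_ends_in (Y : {set C}) : #|[set s : segment L | (seg_end s).1 \in Y]| = (2 * #|Y|)%N.
Proof.
rewrite -(card_half_strands_in true) -(card_imset _ seg_end_inj); congr #|pred_of_set _|.
apply/setP => h; rewrite !inE; apply/imsetP/andP => [[s sY ->]|].
  by rewrite incoming_end; move: sY; rewrite inE.
elim/half_strand_ends: h => s [sY]; first by rewrite incoming_start.
by exists s; rewrite ?inE.
Qed.

Lemma card_inner_exiting (Y : {set C}) :
  (#|inner_segments Y| + #|exiting_segments Y| = 2 * #|Y|)%N.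
Proof.
rewrite -card_starts_in -[RHS](cardsID [set s | (seg_end s).1 \in Y]).
by congr (_ + _)%N; apply: eq_card => s; rewrite !inE // andbC.
Qed.

Lemma card_inner_entering (Y : {set C}) :
  (#|inner_segments Y| + #|entering_segments Y| = 2 * #|Y|)%N.
Proof.
rewrite -card_ends_in -[RHS](cardsID [set s | (seg_start s).1 \in Y]).
by congr (_ + _)%N; apply: eq_card => s; rewrite !inE // andbC.
Qed.

(** Conservation of flow: each crossing has two incoming and two outgoing half-strands. *)
Lemma card_exiting_entering (Y : {set C}) : #|exiting_segments Y| = #|entering_segments Y|.
Proof. by apply/eqP; rewrite -(eqn_add2l #|inner_segments Y|) card_inner_exiting card_inner_entering. Qed.

(* The boundary of a region leaves a set of crossings as often as it enters it. *)
Lemma region_reenters (Y : {set C}) (h : H) : h.1 \in Y -> (opp L h).1 \notin Y ->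
  exists2 g, region_of g = region_of h & (g.1 \notin Y) && ((opp L g).1 \in Y).
Proof.
move=> hY hoY.
have [/existsP [g /andP [/eqP]]|/existsPn nex] :=
  boolP [exists g, (region_of g == region_of h) && ((g.1 \notin Y) && ((opp L g).1 \in Y))].
  by exists g.
pose A := [set g in region_of h | g.1 \in Y].
have : bd @^-1: A == A.
  rewrite eqEcard card_preimset ?leqnn ?andbT; last exact: perm_inj.
  apply/subsetP => g; rewrite !inE mem_region_bd ?region_of_regions // bd_crossing.
  move=> /andP [gh goY]; have := nex g; rewrite gh goY andbT /= negb_and negbK.
  by rewrite -mem_regionE ?region_of_regions // gh.
move/eqP/setP/(_ h); rewrite !inE mem_region_bd ?region_of_regions // bd_crossing.
by rewrite mem_region_of hY (negbTE hoY).
Qed.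

Hypothesis L_prime_like : prime_like L.
Hypothesis L_reduced : forall c : C, ~ nugatory c.

Lemma region_corner_inj (c : C) : injective (fun k => region_of ((c, k) : H)).
Proof.
move=> k l kl; apply/eqP; apply: contraT => neq_kl.
by case: (L_reduced (c := c)); exists k, l.
Qed.

(** The two sides of a segment are two corners of the same crossing, which would be nugatory if they
    shared a region. *)
Lemma region_opp_neq (h : H) : region_of (opp L h) != region_of h.
Proof.
rewrite region_opp turnE [h in X in _ != X]surjective_pairing.
apply/eqP => /region_corner_inj.
by case: h => c [[|[|[|[|k]]]] //= lt_k] /(congr1 val).
Qed.

(** If no segment leaves [Y], none enters it and connectedness fails. If a single [j] leaves, a
    single [k] enters, and a curve through [j] and [k] encloses [Y], against primeness. *)
Lemma exiting_segments_ge2 (Y : {set C}) :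
  Y != set0 -> Y != setT -> (1 < #|exiting_segments Y|)%N.
Proof.
move=> Y0 YT; rewrite ltnNge; apply/negP => le1.
have [out0|] := posnP #|exiting_segments Y|.
  have in0 : #|entering_segments Y| = 0%N by rewrite -card_exiting_entering.
  have Yc : forall c d, (c \in Y) = (d \in Y).
    apply: (crossing_const L_connected) => h.
    have Ys s : ((seg_start s).1 \in Y) = ((seg_end s).1 \in Y).
      have := cards0_eq out0 => /setP /(_ s); have := cards0_eq in0 => /setP /(_ s).
      by rewrite !inE; case: (_ \in Y); case: (_ \in Y).
    by elim/half_strand_ends: h => s; rewrite ?opp_seg_end Ys.
  case/set0Pn: Y0 => c cY; case/eqP: YT; apply/setP => d.
  by rewrite inE (Yc d c).
move=> gt0; have out1 : #|exiting_segments Y| = 1%N by apply/eqP; rewrite eqn_leq le1.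
have /eqP/cards1P [k inE'] : #|entering_segments Y| = 1%N by rewrite -card_exiting_entering.
move/eqP/cards1P: out1 => [j outE].
have outP s : (((seg_start s).1 \in Y) && ((seg_end s).1 \notin Y)) = (s == j).
  by have /setP/(_ s) := outE; rewrite !inE.
have inP s : (((seg_start s).1 \notin Y) && ((seg_end s).1 \in Y)) = (s == k).
  by have /setP/(_ s) := inE'; rewrite !inE.
have /andP [jY jY'] := etrans (outP j) (eqxx j).
have /andP [kY kY'] := etrans (inP k) (eqxx k).
apply: L_prime_like; exists j, k, Y; split => //; split; last first.
  move=> s; rewrite -outP -inP.
  by case: (_ \in Y); case: (_ \in Y).
suff [lE rE] : left_region j = left_region k /\ right_region j = right_region k by rewrite lE rE.
rewrite !left_regionE !right_regionE; split.
  (* The region to the left of [j] leaves [Y] along [j] and must come back. Coming back along [j]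
     would put it on both sides of [j], so it returns along [k], on the left. *)
  have [g] := region_reenters jY jY'.
  elim/half_strand_ends: g => s gj; first by rewrite inP => /eqP <-.
  rewrite opp_seg_end andbC outP => /eqP sj.
  by have := region_opp_neq (seg_start j); rewrite -gj -sj eqxx.
(* The right sides are compared in the same way, from the complement of [Y]. *)
have [||g] := @region_reenters (~: Y) (seg_end j); rewrite ?opp_seg_end ?inE ?negbK //.
elim/half_strand_ends: g => s gj.
  rewrite outP => /eqP sj.
  by have := region_opp_neq (seg_start j); rewrite -/(seg_end j) -gj sj eqxx.
by rewrite opp_seg_end andbC inP => /eqP <-.
Qed.

(** Indecomposable sets have at most [2 * #|Y| - 2] inner segments, hence cycle rank at most
    [#|Y| - 1]. Otherwise [Y] splits into two parts and induction applies to each. *)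
Lemma inner_regions_lt (Y : {set C}) :
  Y != set0 -> Y != setT -> (#|inner_regions Y| < #|Y|)%N.
Proof.
have [n] := ubnP #|Y|; elim: n Y => // n IHn Y ltYn Y0 YT.
pose splits (A : {set C}) := [&& A \subset Y, A != set0, A != Y &
  [forall s in inner_segments Y, ((seg_start s).1 \in A) == ((seg_end s).1 \in A)]].
have [/existsP [A /and4P [sAY A0 AY /forall_inP splA]]|/existsPn nospl] := boolP [exists A, splits A].
  have ltAY : (#|A| < #|Y|)%N by rewrite proper_card // properEneq AY.
  have cardY := cardsD Y A; rewrite (setIidPr sAY) in cardY.
  have gtA0 : (0 < #|A|)%N by rewrite card_gt0.
  have ltDY : (#|Y :\: A| < #|Y|)%N by rewrite cardY ltn_subrL gtA0 (leq_trans _ ltAY).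
  have D0 : Y :\: A != set0 by rewrite -card_gt0 cardY subn_gt0.
  have subT (B : {set C}) : B \subset Y -> B != setT.
    by move=> sBY; apply: contraNneq YT => BT; rewrite -subTset -BT.
  have ltA := IHn A (leq_trans ltAY ltYn) A0 (subT _ sAY).
  have ltD := IHn _ (leq_trans ltDY ltYn) D0 (subT _ (subsetDl _ _)).
  have -> : #|Y| = (#|A| + #|Y :\: A|)%N by rewrite cardY subnKC // ltnW.
  apply: leq_ltn_trans (_ : (#|inner_regions A| + #|inner_regions (Y :\: A)|) < _)%N; last lia.
  apply: leq_trans (leq_card_setU _ _); apply: subset_leq_card; apply/subsetP => r rY.
  have [h rE] : exists h, r = region_of h by apply/regionsP; move: rY; rewrite inE => /andP [].
  rewrite rE in rY *.
  (* Consecutive corners of an inner region are joined by an inner segment of [Y], which the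
     splitting does not cut. *)
  have gA : forall g, g \in region_of h -> (g.1 \in A) = (h.1 \in A).
    apply: region_const => g /region_ofP gh; rewrite bd_crossing.
    have sA s : s \in inner_segments Y -> ((seg_start s).1 \in A) = ((seg_end s).1 \in A).
      by move=> /splA /eqP.
    move: rY; rewrite gh => /inner_region_opp.
    elim/half_strand_ends: g {gh} => s; first by move=> sY; rewrite -/(seg_end s) sA ?inE.
    by rewrite opp_seg_end andbC => sY; rewrite sA ?inE.
  have gY := inner_regionsP _ _ rY.
  rewrite inE; case hA : (h.1 \in A); apply/orP; [left|right]; apply/inner_regionsP => g gh.
    by rewrite gA.
  by rewrite inE gA // hA gY.
have Y_ind : indecomposable Y.
  move=> A sAY A0 AY; have := nospl A; rewrite /splits sAY A0 AY /=.
  by move=> /forall_inPn [s]; exists s.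
have := inner_regions_connected_le YT Y_ind.
have := card_inner_exiting Y; have := exiting_segments_ge2 Y0 YT; lia.
Qed.

End InnerRegions.

(** * States and perfect matchings *)

Section States.
Variable L : link_diagram.
Hypothesis L_connected : connected_diagram L.
Hypothesis L_reduced : forall c : crossing L, ~ nugatory c.
Variable i : segment L.
Local Notation H := (half_strand L).
Local Notation C := (crossing L).
Local Notation state := {ffun C -> 'I_4}.
Local Notation G := (truncated_graph i).

Definition marked_region (S : state) (c : C) : {set H} := region_of ((c, S c) : H).

Definition marked (S : state) (h : H) : bool := S h.1 == h.2.

(** Without nugatory crossings, a region determines the corner at which it touches a given
    crossing. *)
Lemma marked_regionE (S : state) (h : H) :
  (region_of h == marked_region S h.1) = marked S h.
Proof.
case: h => c k; rewrite /marked /= eq_sym.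
by apply/eqP/eqP => [/region_corner_inj -> //|<-].
Qed.

Lemma card_present : #|present_regions i| = #|C|.
Proof.
have sub : absent_regions i \subset regions L.
  by apply/subsetP => r; rewrite !inE => /orP [] /eqP ->; apply: region_of_regions.
rewrite cardsD (setIidPr sub) card_regions // cards2 left_regionE right_regionE.
by rewrite eq_sym region_opp_neq // addnK.
Qed.

Lemma region_present (h : H) :
  (region_of h \in present_regions i) = (region_of h \notin absent_regions i).
Proof. by rewrite inE region_of_regions andbT. Qed.

(** There are as many present regions as crossings, so surjectivity follows from injectivity. *)
Lemma kauffman_stateP (S : state) :
  reflect (injective (marked_region S) /\ forall c, marked_region S c \in present_regions i)
          (kauffman_state i S).
Proof.
apply: (iffP andP) => [[/injectiveP S_inj /eqP imS]|[S_inj Sp]].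
  by split => // c; rewrite -imS imset_f.
split; first exact/injectiveP.
rewrite eqEcard; apply/andP; split; last by rewrite card_present card_imset.
by apply/subsetP => _ /imsetP [c _ ->]; apply: Sp.
Qed.

Lemma present_marked (S : state) (r : {set H}) :
  kauffman_state i S -> r \in present_regions i -> exists c, r = marked_region S c.
Proof. by case/andP => _ /eqP <- /imsetP [c _ ->]; exists c. Qed.

Lemma mem_state_matching (S : state) (c : C) (r : {set H}) :
  ((c, r) \in state_matching S) = (r == marked_region S c).
Proof. by apply/imsetP/eqP => [[d _ [-> ->]]|->] //; exists c. Qed.

Lemma state_matching_inj : injective (@state_matching L).
Proof.
move=> S S' SS'; apply/ffunP => c; apply: (region_corner_inj L_reduced (c := c)).
change (marked_region S c = marked_region S' c).
by apply/eqP; rewrite -(mem_state_matching S') -SS' mem_state_matching.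
Qed.

Lemma state_matching_perfect (S : state) :
  kauffman_state i S -> perfect_matching G (state_matching S).
Proof.
move=> SS; have [S_inj Sp] := kauffman_stateP _ SS; apply/and3P; split.
- apply/subsetP => _ /imsetP [c _ ->]; rewrite !inE /=; apply/andP; split.
    by apply/existsP; exists (S c).
  by have := Sp c; rewrite region_present !inE.
- apply/forallP => c; apply/cards1P; exists (c, marked_region S c).
  apply/setP => -[d r]; rewrite !inE mem_state_matching xpair_eqE /= andbC.
  by case: eqP => [->|].
apply/forall_inP => w /(present_marked SS) [c ->]; apply/cards1P.
exists (c, marked_region S c); apply/setP => -[d r].
rewrite !inE mem_state_matching xpair_eqE /=.
by apply/andP/andP => [[/eqP -> /eqP /S_inj ->]|[/eqP -> /eqP ->]]; rewrite !eqxx.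
Qed.

Lemma perfect_matching_state (M : {set C * {set H}}) :
  perfect_matching G M -> exists2 S, kauffman_state i S & M = state_matching S.
Proof.
case/and3P => /subsetP ME /forallP MC /forall_inP MW.
(* The default [ord0] is never reached, because [M] has an edge at every crossing. *)
pose S : state := [ffun c => odflt ord0 [pick k | (c, region_of ((c, k) : H)) \in M]].
have SM c : (c, marked_region S c) \in M.
  rewrite /marked_region ffunE; case: pickP => [k //|noM].
  have /cards1P [[d r] Me] := MC c.
  have : (d, r) \in [set e in M | e.1 == c] by rewrite Me set11.
  rewrite inE /= => /andP [drM /eqP dc]; have := ME _ drM.
  by rewrite !inE /= => /andP [/existsP [k /eqP rE] _]; have := noM k; rewrite -dc rE drM.
have Sp c : marked_region S c \in present_regions i.
  by have := ME _ (SM c); rewrite region_present !inE => /andP [].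
exists S; last first.
  apply/setP => -[c r]; rewrite mem_state_matching; apply/idP/eqP => [crM|-> //].
  have /cards1P [e Me] := MC c.
  have : (c, r) \in [set e in M | e.1 == c] by rewrite inE crM /=.
  have : (c, marked_region S c) \in [set e in M | e.1 == c] by rewrite inE SM /=.
  by rewrite Me !inE => /eqP <- /eqP [].
apply/kauffman_stateP; split => // c d cd.
have /cards1P [e Me] := MW _ (Sp c).
have : (c, marked_region S c) \in [set e in M | e.2 == marked_region S c] by rewrite inE SM /=.
have : (d, marked_region S d) \in [set e in M | e.2 == marked_region S c].
  by rewrite inE SM /= cd.
by rewrite Me !inE => /eqP <- /eqP [].
Qed.

(** For a loop from position [k] to position [l] of one crossing, matching the regions on both sides
    gives [l = k - 1] and [k = l - 1] modulo 4, which is impossible. *)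
Lemma crossing_ends_neq (j : segment L) : (seg_start j).1 != (seg_end j).1.
Proof.
apply/eqP; have := region_turn_opp (seg_start j); rewrite -/(seg_end j).
have := region_opp (seg_start j); rewrite -/(seg_end j).
case: (seg_start j) (seg_end j) => [c k] [d l] e1 e2 /= cd; subst d.
move: e1 e2; rewrite !turnE /= => /(region_corner_inj L_reduced) -> /(region_corner_inj L_reduced).
by case: k => -[|[|[|[|k]]]] //= lt_k /(congr1 val).
Qed.

(* The effect on markers of a down-flip at [f_j]; meaningful only if both ends
   of [j] are marked. *)
Definition state_flip (j : segment L) (S : state) : state :=
  [ffun c => if c == (seg_start j).1 then ord_pred (seg_start j).2
             else if c == (seg_end j).1 then ord_pred (seg_end j).2 else S c].

Definition flippable (S : state) (j : segment L) : bool :=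
  marked S (seg_start j) && marked S (seg_end j).

(** The two markers exchange their regions, which are the two sides of [j]. This transposition is
    the one seen by the determinant. *)
Lemma marked_region_flip (j : segment L) (S : state) (c : C) : flippable S j ->
  marked_region (state_flip j S) c =
  marked_region S (tperm (seg_start j).1 (seg_end j).1 c).
Proof.
case/andP; rewrite -!marked_regionE => /eqP sE /eqP eE.
rewrite {1}/marked_region ffunE; case: eqP => [->|/eqP cs].
  by rewrite tpermL -eE -[(_, ord_pred _)]turnE -region_opp.
case: eqP => [->|/eqP ce]; first by rewrite tpermR -sE -[(_, ord_pred _)]turnE region_turn_opp.
by rewrite tpermD // eq_sym.
Qed.

Lemma state_flip_state (j : segment L) (S : state) :
  kauffman_state i S -> flippable S j -> kauffman_state i (state_flip j S).
Proof.
move=> /kauffman_stateP [S_inj Sp] Sj; apply/kauffman_stateP; split => [c d|c].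
  by rewrite !marked_region_flip // => /S_inj /perm_inj.
by rewrite marked_region_flip.
Qed.

Lemma flippable_present (S : state) (j : segment L) : kauffman_state i S -> flippable S j ->
  (left_region j \in present_regions i) && (right_region j \in present_regions i).
Proof.
move=> /kauffman_stateP [_ Sp] /andP [].
by rewrite -!marked_regionE left_regionE right_regionE => /eqP -> /eqP ->; rewrite !Sp.
Qed.

Lemma state_matching_flip (j : segment L) (S : state) : flippable S j ->
  state_matching (state_flip j S) =
  (state_matching S :\: bw G j) :|: wb G j.
Proof.
move=> Sj; apply/setP => -[c r]; rewrite 2!inE !mem_state_matching marked_region_flip //.
case/andP: (Sj); rewrite -!marked_regionE -left_regionE -right_regionE => /eqP sE /eqP eE.
rewrite !inE !xpair_eqE; have ne := crossing_ends_neq j.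
have [->|cs] := eqVneq c (seg_start j).1.
  rewrite tpermL -eE -sE (negbTE ne) /= orbF.
  by case: (r == left_region j).
have [->|ce] := eqVneq c (seg_end j).1.
  rewrite tpermR -eE -sE /= orbF.
  by case: (r == right_region j).
by rewrite tpermD 1?eq_sym //= orbF.
Qed.

Lemma down_flip_state (j : segment L) (S S' : state) :
  kauffman_state i S -> kauffman_state i S' ->
  down_flip G j (state_matching S) (state_matching S') =
  flippable S j && (S' == state_flip j S).
Proof.
move=> SS SS'; rewrite /down_flip !state_matching_perfect //=.
have -> : (bw G j \subset state_matching S) = flippable S j.
  rewrite subUset !sub1set !mem_state_matching.
  by rewrite left_regionE right_regionE !marked_regionE.
have [Sj|] := boolP (flippable S j); last by rewrite andbF.
rewrite -state_matching_flip // (inj_eq state_matching_inj) !inE andTb.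
(* The face survives truncation: both regions beside [j] carry markers, so they are present. *)
have -> // : [forall e in bw G j :|: wb G j, e.2 \notin absent_regions i].
apply/forall_inP => e.
have /andP [] := flippable_present SS Sj; rewrite !in_setD => /andP [lp _] /andP [rp _].
rewrite !in_set2 in lp rp.
by rewrite in_setU !in_set2 -!orbA => /or4P [] /eqP ->.
Qed.

End States.

(** * The minimum matching *)

Section Clock.
Variable L : link_diagram.
Hypothesis L_connected : connected_diagram L.
Hypothesis L_prime_like : prime_like L.
Hypothesis L_reduced : forall c : crossing L, ~ nugatory c.
Variable i : segment L.
Local Notation H := (half_strand L).
Local Notation C := (crossing L).
Local Notation turn := (turn C).
Local Notation bd := (boundary_perm (opp L)).
Local Notation state := {ffun C -> 'I_4}.
Local Notation G := (truncated_graph i).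

(* If no segment is flippable, walking from each segment of maximal height to
   the next one counterclockwise around an unmarked end eventually closes up.
   The cycle bounds a set [Y] of crossings containing as many regions as
   crossings, against [inner_regions_lt]. *)
Lemma flippable_exists (S : state) (D : segment L -> rat) :
  kauffman_state i S ->
  (forall h, ~~ marked S h -> D (seg_of h) <= D (seg_of (ccw h))) ->
  (forall h, region_of h \in absent_regions i -> D (seg_of h) = 0) ->
  (exists s, 0 < D s) -> exists j, flippable S j.
Proof.
move=> SS Dccw D0 [s0 Ds0].
have [S_inj Sp] := kauffman_stateP L_connected L_reduced _ _ SS.
have [/existsP //|/existsPn noflip] := boolP [exists j, flippable S j]; exfalso.
(* Since [s] is not flippable, at least one of its ends is unmarked; [p] selects such an end. *)
pose p s := if marked S (seg_start s) then seg_end s else seg_start s.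
have p_unmarked s : ~~ marked S (p s).
  by rewrite /p; case: ifP => [sm|->//]; have := noflip s; rewrite /flippable sm.
have seg_of_p s : seg_of (p s) = s by rewrite /p; case: ifP; rewrite ?seg_of_end ?seg_of_start.
pose nxt s := seg_of (ccw (p s)).
have D_nxt s : D s <= D (nxt s) by rewrite -{1}(seg_of_p s) Dccw.
pose m := D [arg max_(s > s0) D s]%O.
have m_max s : D s <= m by rewrite /m; case: arg_maxP => // t _; apply.
have m_gt0 : 0 < m by apply: lt_le_trans Ds0 (m_max s0).
(* A minimal nonempty set of highest segments stable under [nxt] is permuted by [nxt], so it
   consists of closed walks. *)
pose closed (Z : {set segment L}) :=
  [&& Z != set0, Z \subset [set s | D s == m] & nxt @: Z \subset Z].
have [|Z /minsetP [/and3P [/set0Pn [z zZ] /subsetP Zm Zcl] Zmin]] := @ex_minset _ closed.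
  exists [set s | D s == m]; apply/and3P; split => //.
    by apply/set0Pn; exists [arg max_(s > s0) D s]%O; rewrite inE.
  apply/subsetP => _ /imsetP [s sm ->]; move: sm; rewrite !inE => /eqP sm.
  by rewrite eq_le m_max -sm D_nxt.
have nxtZ : nxt @: Z = Z.
  apply: Zmin => //; apply/and3P; split.
  - by apply/set0Pn; exists (nxt z); apply: imset_f.
  - by apply: subset_trans Zcl _; apply/subsetP.
  - exact: imsetS.
have nxt_inj : {in Z &, injective nxt} by apply/imset_injP; rewrite nxtZ.
(* The indicator of the corners crossed by the walk. Each segment of [Z] is entered once and left
   once, so [x] is closed around segments and has a potential. *)
pose x h : rat := ((seg_of h \in Z) && (p (seg_of h) == h))%:R.
have sum_x (f : H -> rat) : \sum_h f h * x h = \sum_(s in Z) f (p s).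
  rewrite sum_half_strands [RHS]big_mkcond; apply: eq_bigr => s _ /=.
  rewrite /x seg_of_start seg_of_end; case: (s \in Z) => /=; last by rewrite !mulr0 addr0.
  rewrite /p; case: ifP => _; rewrite eqxx mulr1.
    by rewrite eq_sym (negbTE (start_neq_end s)) mulr0 add0r.
  by rewrite (negbTE (start_neq_end s)) mulr0 addr0.
have sum_Z s : \sum_(s' in Z) (s' == s)%:R = (s \in Z)%:R :> rat.
  rewrite big_mkcond -[RHS](sum_delta (fun s => (s \in Z)%:R)).
  by apply: eq_bigr => s' _; rewrite eq_sym; case: (s' \in Z); rewrite ?mul1r ?mul0r.
have out_x s : x (seg_start s) + x (seg_end s) = (s \in Z)%:R.
  rewrite -sum_ends -(sum_indicator (fun h => seg_of h == s)).
  under eq_bigr do rewrite mulrC.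
  by rewrite sum_x -sum_Z; apply: eq_bigr => s' _; rewrite seg_of_p.
have in_x s : x (turn (seg_start s)) + x (turn (seg_end s)) = (s \in Z)%:R.
  rewrite -(sum_ends (x \o turn)) -(sum_indicator (fun h => seg_of h == s)).
  rewrite (reindex_inj (can_inj (@ccwK L))) /=.
  under eq_bigr do rewrite ccwK mulrC.
  rewrite (sum_x (fun h => (seg_of (ccw h) == s)%:R)) -sum_Z -{2}nxtZ.
  by rewrite big_imset.
have [phi [psi xE]] : exists (phi : C -> rat) (psi : {set H} -> rat),
    forall h, x h = phi h.1 - psi (region_of h).
  apply: potential_exists => // h; elim/half_strand_ends: h => s.
    by rewrite -/(seg_end s) out_x in_x.
  by rewrite opp_seg_end addrC out_x addrC in_x.
have psi_marked c : psi (marked_region S c) = phi c.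
  have := xE (c, S c); rewrite /x [_ == (c, S c)](_ : _ = false) ?andbF.
    by move/esym/eqP; rewrite subr_eq0 => /eqP <-.
  by apply: contraNF (p_unmarked (seg_of (c, S c))) => /eqP ->; rewrite /marked eqxx.
have psi_le h : psi (region_of h) <= phi h.1 by rewrite -subr_ge0 -xE ler0n.
(* Heights vanish along absent regions, whereas the maximum is positive. *)
have p_present : region_of (p z) \in present_regions i.
  rewrite region_present; apply/negP => /D0; rewrite seg_of_p => Dz0.
  by have := Zm z zZ; rewrite inE Dz0 => /eqP m0; rewrite -m0 ltxx in m_gt0.
have [c' pE] := present_marked SS p_present.
have phi_lt : phi c' < phi (p z).1.
  have := xE (p z); rewrite /x seg_of_p zZ eqxx pE psi_marked => /eqP.
  by rewrite eq_sym subr_eq => /eqP ->; rewrite ltrDr ltr01.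
(* The region marked at [c] has potential [phi c], and each of its corners lies at a crossing of at
   least that potential. Hence the crossings of [Y] mark distinct regions inside [Y]. *)
pose Y := [set c | phi c' < phi c].
have Y0 : Y != set0 by apply/set0Pn; exists (p z).1; rewrite inE.
have YT : Y != setT.
  by apply/eqP => /setP/(_ c'); rewrite !inE ltxx.
have := inner_regions_lt L_connected L_prime_like L_reduced Y0 YT.
rewrite ltnNge -(card_imset _ S_inj) subset_leq_card //.
apply/subsetP => _ /imsetP [c cY ->]; apply/inner_regionsP => h /region_ofP hE.
have := psi_le h; rewrite -hE -/(marked_region S c) psi_marked !inE in cY *.
exact: lt_le_trans.
Qed.

Lemma sum_marked_crossing (S : state) (c : C) :
  \sum_(h : H | h.1 == c) (marked S h)%:R = 1 :> rat.
Proof.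
rewrite (bigD1 (c, S c)) //= /marked eqxx big1 ?addr0 // => -[d k] /= /andP [/eqP ->].
by rewrite xpair_eqE eqxx /= eq_sym => /negbTE ->.
Qed.

Lemma sum_marked_region (S : state) (r : {set H}) :
  kauffman_state i S -> r \in regions L ->
  \sum_(h in r) (marked S h)%:R = (r \in present_regions i)%:R :> rat.
Proof.
move=> SS rR; have [S_inj Sp] := kauffman_stateP L_connected L_reduced _ _ SS.
have [rp|rp] := boolP (r \in present_regions i).
  have [c rE] := present_marked SS rp.
  rewrite (bigD1 (c, S c)) /=; last by rewrite rE mem_region_of.
  rewrite {1}/marked eqxx big1 ?addr0 // => h /andP [hr hc].
  case hm : (marked S h) => //; case/negP: hc.
  move: hr; rewrite mem_regionE // rE; move: (hm); rewrite -marked_regionE // => /eqP -> /eqP/S_inj hc.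
  by move/eqP: hm => hS; rewrite -hc hS -surjective_pairing.
rewrite big1 // => h hr; case hm : (marked S h) => //; case/negP: rp.
move: hr; rewrite mem_regionE // => /eqP <-; move: hm; rewrite -marked_regionE // => /eqP ->.
exact: Sp.
Qed.

(** The height of [S] above [S0]. The second condition fixes the additive constant, and the sign
    makes a down-flip of [S] at [j] lower [D j] by one. *)
Definition is_height (S0 S : state) (D : segment L -> rat) : Prop :=
  (forall h, D (seg_of (ccw h)) - D (seg_of h) = (marked S0 h)%:R - (marked S h)%:R) /\
  (forall h, region_of h \in absent_regions i -> D (seg_of h) = 0).

Lemma is_height_exists (S0 S : state) : kauffman_state i S0 -> kauffman_state i S ->
  exists D, is_height S0 S D.
Proof.
move=> SS0 SS; pose x h : rat := (marked S0 h)%:R - (marked S h)%:R.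
have [c|r rR|D DE] := @height_exists L L_connected x.
- by rewrite sumrB !sum_marked_crossing subrr.
- by rewrite sumrB !sum_marked_region // subrr.
exists (fun s => D s - D i); split => [h|h].
  by rewrite opprB addrA subrK -DE.
(* No state has a marker in an absent region, so [D] does not jump along it. Both absent regions
   border [i], so subtracting [D i] normalises the two at once. *)
have Dr g : region_of g \in absent_regions i ->
    forall h, region_of h = region_of g -> D (seg_of h) = D (seg_of g).
  move=> ga h' /esym/region_ofP; apply: (region_const (f := D \o @seg_of L)) => g' /region_ofP gE /=.
  have := DE (bd g'); rewrite bdE turnK seg_of_opp => /eqP.
  suff -> : x (turn (opp L g')) = 0 by rewrite eq_sym subr_eq0 => /eqP.
  have um T : kauffman_state i T -> marked T (turn (opp L g')) = false.
    move=> TT; apply: negbTE; rewrite -marked_regionE // region_turn_opp -gE.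
    apply/eqP => rE; have [_ Tp] := kauffman_stateP L_connected L_reduced _ _ TT.
    by have := Tp (turn (opp L g')).1; rewrite -rE region_present ga.
  by rewrite /x !um // subrr.
rewrite !inE left_regionE right_regionE => /orP [] /eqP hE.
  by rewrite (Dr (seg_start i)) ?seg_of_start ?subrr // !inE eqxx.
by rewrite (Dr (seg_end i)) ?seg_of_end ?subrr // !inE right_regionE eqxx orbT.
Qed.

(** The change of markers is the coboundary of the indicator of [j]. *)
Lemma marked_flip (S : state) (j : segment L) (h : H) : flippable S j ->
  (marked (state_flip j S) h)%:R - (marked S h)%:R =
  (seg_of (ccw h) == j)%:R - (seg_of h == j)%:R :> rat.
Proof.
move=> /andP [/eqP sm /eqP em]; have ne := crossing_ends_neq L_reduced j.
have ccwE g : (ccw h == g) = (h == turn g) by apply/eqP/eqP => [<-|->]; rewrite ?ccwK ?turnK.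
rewrite !seg_of_eq !ccwE /marked ffunE !turnE.
case: h {ccwE} => c k /=; case: (seg_start j) (seg_end j) sm em ne => [a m] [b n] /= sm em ne.
rewrite !xpair_eqE.
have [->|ca] := eqVneq c a; first by rewrite sm (negbTE ne) /= !orbF [k == _]eq_sym [k == m]eq_sym.
have [->|cb] := eqVneq c b; first by rewrite em /= [k == _]eq_sym [k == n]eq_sym.
by rewrite subrr.
Qed.

(** [D - D'] differs from the indicator of [j] by a constant, which is zero at [i]: the segment [i]
    cannot be flipped. *)
Lemma height_sum_flip (S0 S : state) (j : segment L) (D D' : segment L -> rat) :
  kauffman_state i S -> flippable S j ->
  is_height S0 S D -> is_height S0 (state_flip j S) D' ->
  \sum_s D' s = \sum_s D s - 1.
Proof.
move=> SS Sj [DE D0] [DE' D0'].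
pose u s := D s - D' s - (s == j)%:R.
have u_const : forall h h', u (seg_of h) = u (seg_of h').
  apply: (half_strand_const (f := u \o @seg_of L)) => // h /=; last by rewrite seg_of_opp.
  apply/eqP; rewrite -subr_eq0; apply/eqP.
  transitivity ((D (seg_of (ccw h)) - D (seg_of h)) - (D' (seg_of (ccw h)) - D' (seg_of h)) -
     ((seg_of (ccw h) == j)%:R - (seg_of h == j)%:R)); first by rewrite /u; ring.
  by rewrite DE DE' -(marked_flip _ Sj); ring.
have ui : u i = 0.
  have ia : region_of (seg_start i) \in absent_regions i by rewrite !inE eqxx.
  have := D0 _ ia; have := D0' _ ia; rewrite /u seg_of_start => -> ->.
  have [ij|_] := eqVneq i j; last by rewrite !subrr.
  by have /andP [] := flippable_present L_connected L_reduced SS Sj; rewrite -ij region_present ia.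
have -> : \sum_s D s = \sum_s (D' s + (s == j)%:R).
  apply: eq_bigr => s _; apply/eqP; rewrite -subr_eq0 opprD addrA; apply/eqP.
  by rewrite -[LHS]/(u s) -(seg_of_start s) (u_const _ (seg_start i)) seg_of_start.
rewrite big_split /= [X in _ = _ + X - 1](_ : _ = 1) ?addrK //.
rewrite -[RHS](sum_delta (fun _ => 1 : rat) j).
by apply: eq_bigr => s _; rewrite mul1r eq_sym.
Qed.

(** Heights are measured from [S1], and [S0] minimises the total height. A state that is higher than
    [S0] somewhere admits a down-flip, which lowers its total. *)
Lemma down_flips_to_minimum (S1 : state) : kauffman_state i S1 ->
  exists2 S0, kauffman_state i S0 & forall S, kauffman_state i S ->
    connect (down_flip_rel G) (state_matching S) (state_matching S0).
Proof.
move=> SS1.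
have /fin_all_exists [h hP] (S : state) : exists D, kauffman_state i S -> is_height S1 S D.
  have [SS|_] := boolP (kauffman_state i S); last by exists (fun=> 0).
  by have [D DP] := is_height_exists SS1 SS; exists D.
pose tot S := \sum_s h S s.
pose S0 := [arg min_(S < S1 | kauffman_state i S) tot S]%O.
have [SS0 tot_min] : kauffman_state i S0 /\ forall S, kauffman_state i S -> tot S0 <= tot S.
  by rewrite /S0; case: arg_minP.
exists S0 => // S.
(* Rational totals are not well-founded, so the induction counts the states of smaller total
   height. *)
have [n] := ubnP #|[set T | kauffman_state i T & tot T < tot S]|.
elim: n S => // n IHn S leSn SS.
have [DE Da] := hP S SS; have [DE0 Da0] := hP S0 SS0.
pose D s := h S s - h S0 s.
have DccwE g : D (seg_of (ccw g)) - D (seg_of g) = (marked S0 g)%:R - (marked S g)%:R.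
  transitivity ((h S (seg_of (ccw g)) - h S (seg_of g)) - (h S0 (seg_of (ccw g)) - h S0 (seg_of g))).
    by rewrite /D; ring.
  by rewrite DE DE0; ring.
have [/existsP Dpos|/existsPn Dneg] := boolP [exists s, 0 < D s].
  have [j Sj] : exists j, flippable S j.
    apply: (flippable_exists SS _ _ Dpos) => g; last by move=> ga; rewrite /D Da ?Da0 ?subrr.
    by move=> /negbTE gm; rewrite -subr_ge0 DccwE gm subr0 ler0n.
  have SS' := state_flip_state L_connected L_reduced SS Sj.
  have tot' : tot (state_flip j S) < tot S.
    by rewrite /tot (height_sum_flip SS Sj (hP S SS) (hP _ SS')) gtrDl ltrN10.
  apply: (connect_trans (connect1 _) (IHn (state_flip j S) _ SS')).
    by apply/existsP; exists j; rewrite down_flip_state // Sj eqxx.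
  rewrite -ltnS; apply: leq_trans leSn; rewrite ltnS; apply: proper_card; apply/properP; split.
    by apply/subsetP => T; rewrite !inE => /andP [-> /lt_trans]; apply.
  by exists (state_flip j S); rewrite !inE SS' ?tot' // ltxx.
(* [D] is nowhere positive, while its sum is nonnegative by minimality of [S0]. *)
have D0 s : D s = 0.
  have Dle t : 0 <= - D t by rewrite oppr_ge0 leNgt.
  have : \sum_t - D t == 0.
    rewrite eq_le sumr_ge0 // andbT sumrN oppr_le0 sumrB subr_ge0.
    exact: tot_min.
  rewrite psumr_eq0 // => /allP /(_ s); rewrite mem_index_enum => /(_ isT).
  by rewrite oppr_eq0 => /eqP.
suff -> : S = S0 by apply: connect0.
apply/ffunP => c; have := DccwE (c, S c); rewrite !D0 subrr {2}/marked eqxx => /eqP.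
rewrite eq_sym subr_eq0 pnatr_eq1 eqb1 => /eqP //.
Qed.

End Clock.

(** * State weights along flips *)

Section FlipChains.
Variables (B W F : finType) (G : bip_plane_graph B W F).
Implicit Types (M N : {set B * W}) (fs : seq F).

Lemma flip_chain_rcons M N M' fs f :
  flip_chain G M fs N -> down_flip G f M' N -> flip_chain G M (rcons fs f) M'.
Proof.
elim: fs M => [|g fs IHfs] M /=.
  by move=> /eqP ->; move=> fN; apply/existsP; exists M'; rewrite fN eqxx.
move=> /existsP [N' /andP [gN' chainN']] fN; apply/existsP; exists N'.
by rewrite gN' IHfs.
Qed.

Lemma matching_le_chain M M' : matching_le G M M' -> exists fs, flip_chain G M fs M'.
Proof.
case/connectP => p; elim: p M' => [|N p IHp] M' /=; first by move=> _ ->; exists [::] => /=.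
move=> /andP [/existsP [f fN] pN] /(IHp _ pN) [fs chainN].
by exists (rcons fs f); apply: flip_chain_rcons chainN fN.
Qed.

Lemma min_matchingP : (exists M, is_minimum G M) -> is_minimum G (min_matching G).
Proof.
by rewrite /min_matching => -[M Mmin]; case: pickP => [N //|/(_ M)]; rewrite Mmin.
Qed.

Lemma chain_toP M : (exists M, is_minimum G M) -> perfect_matching G M ->
  flip_chain G (min_matching G) (chain_to G M) M.
Proof.
move=> /min_matchingP /andP [_ /forall_inP minM] Mp.
exact: (ClassicalEpsilon.epsilon_spec _ (fun fs => flip_chain G (min_matching G) fs M))
  (matching_le_chain (minM M Mp)).
Qed.

End FlipChains.

Section Mmap.
Import mpoly.
Lemma mmap_sum_prod_var (n : nat) (K : comNzRingType) (g : 'I_n -> K)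
    (I J : finType) (P : pred I) (s : I -> seq J) (f : J -> 'I_n) :
  mmap intr g (\sum_(x | P x) \prod_(j <- s x) 'X_(f j) : {mpoly int[n]}) =
  \sum_(x | P x) \prod_(j <- s x) g (f j).
Proof.
rewrite (raddf_sum (mmap (intr : {rmorphism int -> K}) g)) /=; apply: eq_bigr => x _.
rewrite (rmorph_prod (mmap (intr : {rmorphism int -> K}) g)) /=.
by apply: eq_bigr => j _; rewrite mmapX mmap1U.
Qed.
End Mmap.

Section Weights.
Variable L : link_diagram.
Hypothesis L_connected : connected_diagram L.
Hypothesis L_reduced : forall c : crossing L, ~ nugatory c.
Variable i : segment L.
Local Notation H := (half_strand L).
Local Notation C := (crossing L).
Local Notation state := {ffun C -> 'I_4}.
Local Notation G := (truncated_graph i).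

Lemma t_neq0 : t != 0.
Proof. by rewrite /t tofrac_eq0 polyX_eq0. Qed.

Definition black_hole (h : H) : bool := incoming h && incoming (ccw h).

Definition signed_weight (h : H) : {fraction {poly int}} :=
  (-1) ^+ black_hole h * corner_weight h.2.

Definition state_weight (S : state) : {fraction {poly int}} :=
  (-1) ^+ black_holes S * bracket S.

Lemma black_holesE (S : state) : black_holes S = (\sum_c black_hole (c, S c))%N.
Proof.
rewrite /black_holes -sum1dep_card big_mkcond; apply: eq_bigr => c _.
by rewrite /black_hole; case: (_ && _).
Qed.

Lemma state_weightE (S : state) : state_weight S = \prod_c signed_weight (c, S c).
Proof.
rewrite /state_weight /bracket big_split /=; congr (_ * _).
by rewrite black_holesE expr_sum.
Qed.

Lemma corner_weight_neq0 (k : 'I_4) : corner_weight k != 0.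
Proof.
rewrite /corner_weight (tnth_nth 0).
by case: k => -[|[|[|[|k]]]] //= _; rewrite ?oppr_eq0 ?oner_neq0 ?t_neq0.
Qed.

Lemma bracket_neq0 (S : state) : bracket S != 0.
Proof. by apply/prodf_neq0 => c _; apply: corner_weight_neq0. Qed.

Lemma state_weight_neq0 (S : state) : state_weight S != 0.
Proof. by rewrite mulf_neq0 ?signr_eq0 ?bracket_neq0. Qed.

(** The quotient of the signed weights of the corners to the left and to the right of [h]; it
    depends only on the direction and level of [h], not on the sign of the crossing. *)
Definition end_factor (h : H) : {fraction {poly int}} :=
  if incoming h then if under h then t^-1 else 1 else if under h then - t else -1.

Lemma signed_weight_turn (h : H) :
  signed_weight h = end_factor h * signed_weight (turn C h).
Proof.
rewrite /signed_weight /end_factor /black_hole turnK turnE /corner_weight !(tnth_nth 0).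
rewrite /incoming /incoming_at /under; have := t_neq0.
by case: h => c [[|[|[|[|k]]]] //= ltk]; case: (positive c) => /= t0;
  rewrite ?expr0 ?expr1 ?mul1r ?mulr1 ?mulN1r ?mulNr ?mulrN ?mulVf ?opprK ?mulr1.
Qed.

Lemma y_specE (j : segment L) : y_spec j = end_factor (seg_start j) * end_factor (seg_end j).
Proof.
rewrite /y_spec /end_factor incoming_start incoming_end.
by case: (under _); case: (under _) => /=; rewrite ?mulr1 ?mulN1r ?mulNr ?mulfV ?t_neq0.
Qed.

(** Only the markers at the two ends of [j] move, each across its half-strand, and the two end
    factors multiply to [y_j]. *)
Lemma state_weight_flip (S : state) (j : segment L) : flippable S j ->
  state_weight S = y_spec j * state_weight (state_flip j S).
Proof.
case/andP => /eqP sm /eqP em; rewrite !state_weightE y_specE.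
have ne := crossing_ends_neq L_reduced j.
rewrite (bigD1 (seg_start j).1) //= (bigD1 (seg_end j).1) 1?eq_sym //=.
rewrite [in RHS](bigD1 (seg_start j).1) //= [in RHS](bigD1 (seg_end j).1) 1?eq_sym //=.
rewrite !ffunE eqxx eq_sym (negbTE ne) eqxx sm em -!surjective_pairing -!turnE.
rewrite (signed_weight_turn (seg_start j)) (signed_weight_turn (seg_end j)).
rewrite [X in _ = _ * (_ * (_ * X))](eq_bigr (fun c => signed_weight (c, S c))).
  by rewrite -[RHS]mulrA [X in _ = _ * X]mulrCA [RHS]mulrA -[X in _ * X = _]mulrA.
by move=> c /andP [/negbTE cs /negbTE ce]; rewrite ffunE cs ce.
Qed.

Lemma flip_chain_cons_state (j : segment L) (fs : seq (segment L)) (S S' : state) :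
  kauffman_state i S -> flip_chain G (state_matching S) (j :: fs) (state_matching S') ->
  exists T, [/\ kauffman_state i T, flippable T j, S = state_flip j T &
               flip_chain G (state_matching T) fs (state_matching S')].
Proof.
move=> SS /existsP [N /andP [jN chainN]].
have [T TT NE] : exists2 T, kauffman_state i T & N = state_matching T.
  by apply: perfect_matching_state => //; case/and5P: jN.
move: jN; rewrite NE down_flip_state // => /andP [Tj /eqP SE].
by exists T; split; rewrite -?NE.
Qed.

Lemma flip_chain_weight (fs : seq (segment L)) (S S' : state) :
  kauffman_state i S -> flip_chain G (state_matching S) fs (state_matching S') ->
  state_weight S' = (\prod_(j <- fs) y_spec j) * state_weight S.
Proof.
elim: fs S => [|j fs IHfs] S SS.
  by move=> /eqP/(state_matching_inj L_reduced) ->; rewrite big_nil mul1r.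
move=> /(flip_chain_cons_state SS) [T [TT Tj -> /(IHfs T TT) ->]].
by rewrite big_cons (state_weight_flip Tj) mulrCA mulrA.
Qed.

Hypothesis L_prime_like : prime_like L.

Lemma is_minimum_exists (S : state) : kauffman_state i S -> exists M, is_minimum G M.
Proof.
move=> SS; have [S0 SS0 S0min] := down_flips_to_minimum L_connected L_prime_like L_reduced SS.
exists (state_matching S0); rewrite /is_minimum state_matching_perfect //.
apply/forall_inP => M /(perfect_matching_state L_connected L_reduced) [T TT ->].
exact: S0min.
Qed.

Lemma min_stateP (S : state) : kauffman_state i S ->
  kauffman_state i (min_state i) /\ state_matching (min_state i) = min_matching G.
Proof.
move=> /is_minimum_exists/min_matchingP /andP [].
move=> /(perfect_matching_state L_connected L_reduced) [S0 SS0 mE] _.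
rewrite /min_state; case: pickP => [T /andP [TT /eqP ->] //|/(_ S0) /=].
by rewrite SS0 -mE eqxx.
Qed.

Lemma min_state_chain (S : state) : kauffman_state i S ->
  flip_chain G (state_matching (min_state i)) (chain_to G (state_matching S)) (state_matching S).
Proof.
move=> SS; have [_ ->] := min_stateP SS; apply: chain_toP; first exact: is_minimum_exists SS.
exact: state_matching_perfect.
Qed.

Lemma chain_to_weight (S : state) : kauffman_state i S ->
  state_weight S =
  (\prod_(j <- chain_to G (state_matching S)) y_spec j) * state_weight (min_state i).
Proof.
move=> SS; have [mS _] := min_stateP SS.
exact: flip_chain_weight mS (min_state_chain SS).
Qed.

Lemma sum_matchings (V : nmodType) (f : {set C * {set H}} -> V) :
  \sum_(M | perfect_matching G M) f M = \sum_(S | kauffman_state i S) f (state_matching S).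
Proof.
transitivity (\sum_(M in @state_matching L @: [set S | kauffman_state i S]) f M).
  apply: eq_bigl => M; apply/idP/imsetP.
    by move=> /(perfect_matching_state L_connected L_reduced) [S SS ->]; exists S; rewrite ?inE.
  by move=> [S]; rewrite inE => SS ->; apply: state_matching_perfect.
rewrite big_imset; last exact: in2W (state_matching_inj L_reduced).
by apply: eq_bigl => S; rewrite inE.
Qed.

(** Each specialised [mrk] is the quotient of the signed weights of its state and of the minimal
    state, whichever chain [epsilon] selects. *)
Lemma specialized_dimer_polyE :
  specialized_dimer_poly i =
  (state_weight (min_state i))^-1 * \sum_(S | kauffman_state i S) state_weight S.
Proof.
rewrite /specialized_dimer_poly /dimer_face_poly /mrk mmap_sum_prod_var sum_matchings mulr_sumr.
apply: eq_bigr => S SS; rewrite (chain_to_weight SS) mulrCA mulVf ?state_weight_neq0 // mulr1.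
by apply: eq_bigr => j _; rewrite enum_rankK.
Qed.

End Weights.

(** * The Alexander determinant as a state sum *)

Section Determinant.
Variable L : link_diagram.
Hypothesis L_connected : connected_diagram L.
Hypothesis L_reduced : forall c : crossing L, ~ nugatory c.
Variable i : segment L.
Local Notation H := (half_strand L).
Local Notation C := (crossing L).
Local Notation state := {ffun C -> 'I_4}.
Local Notation G := (truncated_graph i).

(** [s] is the permutation of the Leibniz expansion to which the corners of [S] contribute. *)
Definition matches (S : state) (s : 'S_#|C|) : bool :=
  [forall c, marked_region S c == nth set0 (enum (present_regions i)) (s (enum_rank c))].

(** Entries are sums over corners; distributing the Leibniz products selects one corner at each
    crossing. *)
Lemma alexander_det_matches :
  alexander_det i = \sum_(S : state) \sum_(s | matches S s) (-1) ^+ s * bracket S.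
Proof.
rewrite (exchange_big_dep xpredT) //=; apply: eq_bigr => s _.
rewrite -mulr_sumr; congr (_ * _).
rewrite (reindex (@enum_rank C)) /=; last exact: onW_bij (@enum_rank_bij C).
under eq_bigr do rewrite mxE enum_rankK /alexander_entry.
rewrite bigA_distr_big_dep /=.
by apply: eq_bigl => S; apply: eq_forallb => c.
Qed.

Lemma size_enum_present : size (enum (present_regions i)) = #|C|.
Proof. by rewrite -cardE card_present. Qed.

Lemma matches_state (S : state) s : matches S s -> kauffman_state i S.
Proof.
move=> /forallP Ss; apply/kauffman_stateP => //; split => [c d|c].
  rewrite (eqP (Ss c)) (eqP (Ss d)) => /eqP.
  rewrite nth_uniq ?size_enum_present ?enum_uniq //.
  by move=> /eqP/val_inj/perm_inj/enum_rank_inj.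
by rewrite (eqP (Ss c)) -mem_enum mem_nth // size_enum_present.
Qed.

Lemma matches_uniq (S : state) s s' : matches S s -> matches S s' -> s = s'.
Proof.
move=> /forallP Ss /forallP Ss'; apply/permP => a; rewrite -[a]enum_valK.
have := etrans (esym (eqP (Ss (enum_val a)))) (eqP (Ss' (enum_val a))) => /eqP.
by rewrite nth_uniq ?size_enum_present ?enum_uniq // => /eqP/val_inj.
Qed.

Lemma matches_exists (S : state) : kauffman_state i S -> exists s, matches S s.
Proof.
move=> /kauffman_stateP [] // S_inj Sp.
have ltS (a : 'I_#|C|) : (index (marked_region S (enum_val a)) (enum (present_regions i)) < #|C|)%N.
  by rewrite -size_enum_present index_mem mem_enum.
have s_inj : injective (fun a => Ordinal (ltS a)).
  move=> a b [] /(congr1 (nth set0 (enum (present_regions i)))).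
  by rewrite !nth_index ?mem_enum // => /S_inj/enum_val_inj.
exists (perm s_inj); apply/forallP => c.
by rewrite permE /= enum_rankK nth_index // mem_enum.
Qed.

Lemma matches_flip (S : state) (j : segment L) s : flippable S j -> matches S s ->
  matches (state_flip j S)
    (tperm (enum_rank (seg_start j).1) (enum_rank (seg_end j).1) * s)%g.
Proof.
move=> Sj /forallP Ss; apply/forallP => c; rewrite marked_region_flip // (eqP (Ss _)) permM.
by rewrite -(inj_tperm _ _ _ (@enum_rank_inj C)).
Qed.

Lemma incoming_ccw_turn (h : H) : incoming (ccw h) = ~~ incoming (turn C h).
Proof.
rewrite turnE /ccw /incoming /incoming_at /=.
by case: h => c [[|[|[|[|k]]]] //= ltk]; case: (positive c).
Qed.

(** [ccw h] and [turn h] belong to the same strand, so one enters and the other leaves. If [h]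
    enters, exactly one of its two corners is a black hole; otherwise neither is. *)
Lemma black_hole_turn (h : H) : black_hole h (+) black_hole (turn C h) = incoming h.
Proof.
rewrite /black_hole turnK incoming_ccw_turn.
by case: (incoming h); case: (incoming (turn C h)).
Qed.

(** Only the marker at the end of [j], an incoming half-strand, changes status. *)
Lemma black_holes_flip (S : state) (j : segment L) : flippable S j ->
  odd (black_holes S) = ~~ odd (black_holes (state_flip j S)).
Proof.
case/andP => /eqP sm /eqP em; rewrite !black_holesE.
have ne := crossing_ends_neq L_reduced j.
rewrite (bigD1 (seg_start j).1) //= (bigD1 (seg_end j).1) 1?eq_sym //=.
rewrite [in RHS](bigD1 (seg_start j).1) //= [in RHS](bigD1 (seg_end j).1) 1?eq_sym //=.
rewrite !ffunE eqxx eq_sym (negbTE ne) eqxx sm em -!surjective_pairing -!turnE.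
rewrite [in RHS](eq_bigr (fun c => black_hole (c, S c) : nat)); last first.
  by move=> c /andP [/negbTE cs /negbTE ce]; rewrite ffunE cs ce.
rewrite !oddD !oddb; have := black_hole_turn (seg_start j); have := black_hole_turn (seg_end j).
rewrite incoming_start incoming_end.
by do 4!case: (black_hole _); case: (odd _).
Qed.

(** A flip changes both parities, so their sum is the same for all states on a chain. *)
Lemma matches_sign_chain (b : bool) (fs : seq (segment L)) (S S' : state) :
  kauffman_state i S ->
  (forall s, matches S s -> odd_perm s (+) odd (black_holes S) = b) ->
  flip_chain G (state_matching S) fs (state_matching S') ->
  forall s, matches S' s -> odd_perm s (+) odd (black_holes S') = b.
Proof.
elim: fs S => [|j fs IHfs] S SS Sb.
  by move=> /eqP/(state_matching_inj L_reduced) <-.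
move=> /(flip_chain_cons_state L_connected L_reduced SS) [T [TT Tj SE chainT]].
apply: (IHfs T) chainT => // s /(matches_flip Tj); rewrite -SE => /Sb.
rewrite odd_permM odd_tperm (inj_eq enum_rank_inj) crossing_ends_neq // SE (black_holes_flip Tj).
by case: (odd_perm s); case: (odd _).
Qed.

Hypothesis L_prime_like : prime_like L.

Lemma alexander_det_state_sum :
  exists b : bool, alexander_det i = (-1) ^+ b * \sum_(S | kauffman_state i S) state_weight S.
Proof.
rewrite alexander_det_matches.
(* If there are no states, the expansion is empty and both sides are zero. *)
have [/existsP [S1 SS1]|/existsPn noS] := boolP [exists S, kauffman_state i S]; last first.
  exists false; rewrite [X in _ * X]big_pred0 ?mulr0 => [|S]; last exact/negbTE/noS.
  rewrite big1 // => S _; rewrite big_pred0 // => s.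
  by apply: contraNF (noS S); apply: matches_state.
have [mS _] := min_stateP L_connected L_reduced L_prime_like SS1.
have [s0 ms0] := matches_exists mS.
exists (odd_perm s0 (+) odd (black_holes (min_state i))).
rewrite mulr_sumr [RHS]big_mkcond; apply: eq_bigr => S _.
case: ifP => [SS|nSS]; last first.
  by rewrite big_pred0 // => s; apply: contraFF nSS; apply: matches_state.
have [s ms] := matches_exists SS.
rewrite (big_pred1 s); last by move=> s' /=; apply/idP/eqP => [/matches_uniq/(_ ms)|->].
rewrite /state_weight mulrA; congr (_ * _).
have sgn0 s' : matches (min_state i) s' ->
    odd_perm s' (+) odd (black_holes (min_state i)) = odd_perm s0 (+) odd (black_holes (min_state i)).
  by move=> ms'; rewrite (matches_uniq ms' ms0).
have chainS := min_state_chain L_connected L_reduced L_prime_like SS.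
rewrite -(matches_sign_chain mS sgn0 chainS ms).
by rewrite -[X in _ = _ * X]signr_odd -signr_addb addbK.
Qed.

End Determinant.

(** * Independence of the deleted regions *)

(** The right-hand factor is completed to a square matrix of determinant [\det Z2] by the columns of
    [P]. The relation makes the product block triangular. *)
Lemma complementary_minors (K : fieldType) (n m : nat) (A : 'M[K]_n) (B : 'M_(n, m))
    (Z1 : 'M_(n, m)) (Z2 : 'M_m) (U : 'M_(m, n + m)) :
  row_mx A B *m col_mx Z1 Z2 = 0 ->
  \det (col_mx (row_mx A B) U) * \det Z2 = \det A * \det (U *m col_mx Z1 Z2).
Proof.
move=> NZ; pose P : 'M[K]_(n + m, n) := col_mx 1%:M 0.
have -> : \det Z2 = \det (row_mx P (col_mx Z1 Z2)).
  by rewrite -block_mxEh det_ublock det1 mul1r.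
rewrite -det_mulmx mul_col_row NZ det_lblock mul_row_col mulmx1 mulmx0 addr0 //.
Qed.

Lemma complementary_minors_perm (K : fieldType) (n m : nat) (A A' : 'M[K]_n) (B B' : 'M_(n, m))
    (Z1 Z1' : 'M_(n, m)) (Z2 Z2' : 'M_m) (s : 'S_(n + m)) :
  row_mx A B = col_perm s (row_mx A' B') -> col_mx Z1 Z2 = row_perm s (col_mx Z1' Z2') ->
  row_mx A B *m col_mx Z1 Z2 = 0 ->
  exists b : bool, (-1) ^+ b * \det A' * \det Z2 = \det A * \det Z2'.
Proof.
(* [U] selects the rows that become the bottom block [Z2'] in the other ordering. *)
move=> NE ZE NZ; pose U : 'M[K]_(m, n + m) := col_perm s (row_mx 0 1%:M).
exists (odd_perm s^-1); have := complementary_minors U NZ.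
have -> : U *m col_mx Z1 Z2 = Z2'.
  rewrite ZE /U col_permE row_permE mulmxA -[_ *m perm_mx s]mulmxA -perm_mxM mulVg perm_mx1 mulmx1.
  by rewrite mul_row_col mul0mx mul1mx add0r.
move=> <-; congr (_ * _).
have -> : col_mx (row_mx A B) U = block_mx A' B' 0 1%:M *m perm_mx s^-1.
  by rewrite NE /U !col_permE -mul_col_mx block_mxEv.
by rewrite det_mulmx det_ublock det1 mulr1 det_perm mulrC.
Qed.

Lemma det_mx2 (R : comPzRingType) (M : 'M[R]_2) :
  \det M = M ord0 ord0 * M ord_max ord_max - M ord0 ord_max * M ord_max ord0.
Proof.
rewrite (expand_det_row _ ord0) !big_ord_recl big_ord0 /cofactor !det_mx11 !mxE /=.
rewrite addr0 expr0 expr1 mul1r mulN1r mulrN.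
by congr (M _ _ * M _ _ - M _ _ * M _ _); apply: val_inj.
Qed.

Lemma injective_perm (m : nat) (T : finType) (f g : 'I_m -> T) :
  injective f -> (forall x, f x \in codom g) -> exists s : 'S_m, forall x, f x = g (s x).
Proof.
move=> f_inj fg; have s_inj : injective (fun x => iinv (fg x)).
  by move=> x y /(congr1 g); rewrite !f_iinv => /f_inj.
by exists (perm s_inj) => x; rewrite permE f_iinv.
Qed.

Section Numbering.
Variable L : link_diagram.
Hypothesis L_connected : connected_diagram L.
Local Notation H := (half_strand L).
Local Notation C := (crossing L).
Local Notation turn := (turn C).

(* Alexander's numbering of the regions. *)
Lemma region_numbering_exists : exists p : {set H} -> int,
  forall h : H, p (region_of h) = p (region_of (turn h)) + (if incoming h then -1 else 1).
Proof.
(* Minus the numbering of the four corners of one crossing, taken relative to corner 0. Its jumps at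
   the two ends of a segment are opposite, so it has a potential. *)
pose x (h : H) : rat := if positive h.1 then [:: 0; -1; - 2; -1]`_h.2 else [:: 0; 1; 0; -1]`_h.2.
pose e (h : H) : int := if incoming h then -1 else 1.
have xE h : x (turn h) = x h + (e h)%:~R.
  rewrite turnE /x /e /incoming /incoming_at /=.
  by case: h => c [[|[|[|[|k]]]] //= ltk]; case: (positive c); rewrite ?addr0 ?add0r.
have e_opp h : e (opp L h) = - e h by rewrite /e incoming_opp; case: (incoming h).
have [h|phi [psi psiE]] := @potential_exists L L_connected x.
  by rewrite !xE e_opp rmorphN /= addrACA subrr addr0.
have psi_turn h : psi (region_of h) = psi (region_of (turn h)) + (e h)%:~R.
  have psiE' g : psi (region_of g) = phi g.1 - x g by rewrite psiE; ring.
  by rewrite !psiE' xE turnE /=; ring.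
case: (pickP H) => [h0 _|noH]; last by exists (fun=> 0) => h; have := noH h.
(* The potential is rational with integral jumps; subtracting its value at a base region makes it
   integral everywhere, and the floor loses nothing. *)
pose f r := psi r - psi (region_of h0).
have f_turn h : f (region_of h) = f (region_of (turn h)) + (e h)%:~R.
  by rewrite /f psi_turn addrAC.
have f_int h : f (region_of h) \is a Num.int.
  rewrite (@half_strand_const L _ (fun h => f (region_of h) \is a Num.int) L_connected _ _ h h0).
  - by rewrite /f subrr rpred0.
  - by move=> g; rewrite f_turn ccwK; apply: rpredDr; apply: intr_int.
  - by move=> g; rewrite region_opp [in RHS]f_turn; apply/esym/rpredDr; apply: intr_int.
exists (fun r => Num.floor (f r)) => h; apply: (@intr_inj rat).
by rewrite rmorphD /= !Num.Theory.floorK // f_turn.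
Qed.

Hypothesis L_reduced : forall c : C, ~ nugatory c.

(** The two deleted regions come last, so that the Alexander determinant is the minor of the leading
    columns. *)
Definition region_list (j : segment L) : seq {set H} :=
  enum (present_regions j) ++ [:: left_region j; right_region j].

Lemma region_list_uniq (j : segment L) : uniq (region_list j).
Proof.
rewrite cat_uniq enum_uniq /= !mem_enum !inE !eqxx /= orbT /= andbT.
by rewrite left_regionE right_regionE eq_sym region_opp_neq.
Qed.

Lemma mem_region_list (j : segment L) (r : {set H}) : (r \in region_list j) = (r \in regions L).
Proof.
rewrite mem_cat mem_enum !inE.
have [->|_] := eqVneq r (left_region j); first by rewrite left_regionE region_of_regions.
have [->|_] := eqVneq r (right_region j); first by rewrite right_regionE region_of_regions.
by rewrite /= orbF.
Qed.

Lemma size_region_list (j : segment L) : size (region_list j) = (#|C| + 2)%N.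
Proof. by rewrite size_cat size_enum_present. Qed.

Definition region_at (j : segment L) (x : 'I_(#|C| + 2)) : {set H} :=
  nth set0 (region_list j) x.

Lemma region_at_inj (j : segment L) : injective (region_at j).
Proof.
move=> x y /eqP; rewrite nth_uniq ?size_region_list ?region_list_uniq //.
by move=> /eqP/val_inj.
Qed.

Lemma mem_codom_region_at (j : segment L) (r : {set H}) :
  (r \in codom (region_at j)) = (r \in regions L).
Proof.
rewrite -(mem_region_list j); apply/codomP/idP => [[x ->]|rl].
  by rewrite mem_nth // size_region_list.
have lt_r : (index r (region_list j) < #|C| + 2)%N by rewrite -(size_region_list j) index_mem.
by exists (Ordinal lt_r); rewrite /region_at nth_index.
Qed.

Lemma sum_region_at (V : nmodType) (j : segment L) (f : {set H} -> V) :
  \sum_x f (region_at j x) = \sum_(r in regions L) f r.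
Proof.
transitivity (\sum_(r in region_at j @: setT) f r).
  rewrite big_imset => [|x y _ _ /region_at_inj //].
  by apply: eq_bigl => x; rewrite inE.
apply: eq_bigl => r; rewrite -(mem_codom_region_at j).
by apply/imsetP/codomP => [[x _ ->]|[x ->]]; exists x.
Qed.

Definition region_matrix (j : segment L) : 'M[{fraction {poly int}}]_(#|C|, #|C| + 2) :=
  \matrix_(a, x) alexander_entry (enum_val a) (region_at j x).

Lemma alexander_detE (j : segment L) : alexander_det j = \det (lsubmx (region_matrix j)).
Proof.
congr (\det _); apply/matrixP => a b; rewrite !mxE /region_at nth_cat size_enum_present //=.
by rewrite ltn_ord.
Qed.

Lemma sum_alexander_entry (c : C) (f : {set H} -> {fraction {poly int}}) :
  \sum_(r in regions L) alexander_entry c r * f r =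
  \sum_(k < 4) corner_weight k * f (region_of ((c, k) : H)).
Proof.
rewrite [RHS](partition_big (fun k => region_of ((c, k) : H)) (mem (regions L))) /=; last first.
  by move=> k _; apply: region_of_regions.
apply: eq_bigr => r _; rewrite /alexander_entry mulr_suml.
by apply: eq_bigr => k /eqP ->.
Qed.

Variable p : {set H} -> int.
Hypothesis p_turn : forall h : H,
  p (region_of h) = p (region_of (turn h)) + (if incoming h then -1 else 1).

Definition region_weight (r : {set H}) : {fraction {poly int}} := t ^ (- p r).

Lemma region_weight_turn (h : H) : region_weight (region_of h) =
  (if incoming h then t else t^-1) * region_weight (region_of (turn h)).
Proof.
rewrite /region_weight p_turn opprD expfzDr ?t_neq0 // mulrC; congr (_ * _).
by case: (incoming h).
Qed.

Lemma corner_weight_sum : \sum_(k < 4) corner_weight k = 0.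
Proof.
rewrite !big_ord_recl big_ord0 /corner_weight !(tnth_nth 0) /=.
by rewrite addr0 subrr addr0 subrr.
Qed.

(** Crossing the under-strand from left to right multiplies the region weight by [t], so the terms
    cancel in pairs across the under-strand. *)
Lemma corner_region_weight_sum (c : C) :
  \sum_(k < 4) corner_weight k * region_weight (region_of ((c, k) : H)) = 0.
Proof.
rewrite !big_ord_recl big_ord0 /corner_weight !(tnth_nth 0) /=.
pose w (k : 'I_4) := region_weight (region_of ((c, k) : H)).
have wE (k : 'I_4) : w (ordS k) = (if incoming ((c, ordS k) : H) then t else t^-1) * w k.
  by rewrite /w region_weight_turn -[(c, ordS k)]/(ccw (c, k)) ccwK.
rewrite -!/(w _) (_ : lift _ (lift _ (lift _ _)) = ordS (ordS (ordS ord0))); last exact: val_inj.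
rewrite (_ : lift _ (lift _ _) = ordS (ordS ord0)); last exact: val_inj.
rewrite (_ : lift _ _ = ordS ord0); last exact: val_inj.
rewrite !wE /incoming /incoming_at /= mul1r mulN1r addr0.
by case: (positive c) => /=;
  rewrite !mulNr ?(mulKf t_neq0) !(mulVKf t_neq0) addKr subrr.
Qed.

Definition relation_matrix (j : segment L) : 'M[{fraction {poly int}}]_(#|C| + 2, 2) :=
  \matrix_(x, b) if b == ord0 then 1 else region_weight (region_at j x).

Lemma region_relation (j : segment L) : region_matrix j *m relation_matrix j = 0.
Proof.
apply/matrixP => a b; rewrite !mxE; under eq_bigr do rewrite !mxE.
have [_|_] := eqVneq b ord0.
  rewrite (sum_region_at j (fun r => alexander_entry (enum_val a) r * 1)) sum_alexander_entry.
  by under eq_bigr do rewrite mulr1; apply: corner_weight_sum.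
rewrite (sum_region_at j (fun r => alexander_entry (enum_val a) r * region_weight r)).
by rewrite sum_alexander_entry corner_region_weight_sum.
Qed.

(** The block has rows [(1, w_left)] and [(1, w_right)], and [w_left] is [t^-1 * w_right] across
    [j]. *)
Lemma det_relation (j : segment L) :
  \det (dsubmx (relation_matrix j)) = (1 - t^-1) * region_weight (right_region j).
Proof.
rewrite det_mx2 !mxE /= /region_at !nth_cat !size_enum_present //=.
rewrite !addKn ![(_ + _ < _)%N]ltnNge !leq_addr /= mul1r mulr1.
have := region_weight_turn (seg_start j); rewrite incoming_start.
by rewrite -/(right_region j) -/(left_region j) mulrBl mul1r => ->.
Qed.

End Numbering.

Lemma t_neq1 : t != 1.
Proof.
rewrite /t -tofrac1 tofrac_eq -subr_eq0 -size_poly_eq0 -[1]/(1%:P).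
by rewrite size_XsubC.
Qed.

Lemma alexander_det_sim (L : link_diagram) (i j : segment L) :
  connected_diagram L -> (forall c : crossing L, ~ nugatory c) ->
  sim (alexander_det i) (alexander_det j).
Proof.
move=> Lc Lr; have [p p_turn] := region_numbering_exists Lc.
have [x|s sE] := injective_perm (region_at_inj Lc Lr (j := i)) (g := region_at j).
  by rewrite mem_codom_region_at // -(mem_codom_region_at Lc Lr i) codom_f.
have NE : row_mx (lsubmx (region_matrix i)) (rsubmx (region_matrix i)) =
    col_perm s (row_mx (lsubmx (region_matrix j)) (rsubmx (region_matrix j))).
  by rewrite !hsubmxK; apply/matrixP => a x; rewrite !mxE sE.
have ZE : col_mx (usubmx (relation_matrix p i)) (dsubmx (relation_matrix p i)) =
    row_perm s (col_mx (usubmx (relation_matrix p j)) (dsubmx (relation_matrix p j))).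
  by rewrite !vsubmxK; apply/matrixP => x b; rewrite !mxE sE.
have [|b] := complementary_minors_perm NE ZE.
  by rewrite hsubmxK vsubmxK region_relation.
rewrite -!alexander_detE // !det_relation //.
have u0 : 1 - t^-1 != 0 by rewrite subr_eq0 eq_sym invr_eq1 t_neq1.
rewrite ![_ * ((1 - t^-1) * _)]mulrCA => /(mulfI u0); rewrite /region_weight => detE.
(* The factor [1 - t^-1] has cancelled; the exponent comes from the quotient of the weights of the
   two right regions. *)
exists b, (p (right_region j) - p (right_region i)).
have w0 : t ^ (- p (right_region j)) != 0 by rewrite expfz_neq0 ?t_neq0.
apply: (mulIf w0); rewrite -detE.
rewrite [in RHS](mulrAC _ _ (alexander_det j)) -[RHS]mulrA; congr (_ * _).
by rewrite -expfzDr ?t_neq0 // addrAC subrr add0r.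
Qed.

(** * Laurent monomials up to sign *)

Lemma sim_sym (P Q : {fraction {poly int}}) : sim P Q -> sim Q P.
Proof.
case=> [b [k ->]]; exists b, (- k).
by rewrite -!mulrA [t ^ _ * _]mulrCA signrMK mulrA -expfzDr ?t_neq0 // addNr expr0z mul1r.
Qed.

Lemma sim_trans (P Q R : {fraction {poly int}}) : sim P Q -> sim Q R -> sim P R.
Proof.
case=> [b [k ->]] [b' [k' ->]]; exists (b (+) b'), (k + k').
by rewrite signr_addb expfzDr ?t_neq0 // !mulrA (mulrAC _ (t ^ k)).
Qed.

Lemma sim_mulr (P Q R : {fraction {poly int}}) : sim P 1 -> sim Q R -> sim (P * Q) R.
Proof.
case=> [b [k ->]]; apply: sim_trans; exists b, k; by rewrite mulr1.
Qed.

Lemma sim_refl (P : {fraction {poly int}}) : sim P P.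
Proof. by exists false, 0; rewrite expr0z !mul1r. Qed.

Lemma sim_sign (b : bool) (P : {fraction {poly int}}) : sim ((-1) ^+ b * P) P.
Proof. by exists b, 0; rewrite expr0z mulr1. Qed.

Lemma sim_inv1 (P : {fraction {poly int}}) : sim P 1 -> sim P^-1 1.
Proof.
case=> [b [k ->]]; exists b, (- k).
by rewrite !mulr1 invfM invr_sign -invr_expz.
Qed.

Lemma corner_weight_sim1 (k : 'I_4) : sim (corner_weight k) 1.
Proof.
rewrite /corner_weight (tnth_nth 0).
case: k => -[|[|[|[|k]]]] //= _.
- exact: sim_refl.
- by exists true, 0; rewrite expr0z !mulr1.
- by exists false, 1; rewrite expr1z mul1r mulr1.
- by exists true, 1; rewrite expr1z mulN1r mulr1.
Qed.

Lemma state_weight_sim1 (L : link_diagram) (S : {ffun crossing L -> 'I_4}) :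
  sim (state_weight S) 1.
Proof.
rewrite /state_weight -signr_odd; apply: sim_trans (sim_sign _ _) _.
apply: (big_ind (fun P => sim P 1)) => [|P Q|c _]; first exact: sim_refl.
  exact: sim_mulr.
exact: corner_weight_sim1.
Qed.

Theorem theorem4p10 (L : link_diagram) (i : segment L)
    (L_connected : connected_diagram L)
    (L_prime_like : prime_like L)
    (L_reduced : forall c : crossing L, ~ nugatory c) :
  specialized_dimer_poly i =
    ((-1) ^+ black_holes (min_state i) * (bracket (min_state i))^-1) *
    \sum_(S : {ffun crossing L -> 'I_4} | kauffman_state i S)
      (-1) ^+ black_holes S * bracket S
  /\ forall Delta : {fraction {poly int}},
       alexander_polynomial L Delta -> sim (specialized_dimer_poly i) Delta.
Proof.
rewrite specialized_dimer_polyE //; split; first by rewrite /state_weight invfM invr_sign.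
move=> Delta [j Dj].
have [b det_i] := alexander_det_state_sum L_connected L_reduced i L_prime_like.
(* The prefactor is the inverse of a state weight, a signed power of [t]. *)
apply: sim_mulr; first exact/sim_inv1/state_weight_sim1.
apply: sim_trans (sim_sym Dj).
apply: sim_trans (alexander_det_sim i j L_connected L_reduced).
by rewrite det_i; apply/sim_sym/sim_sign.
Qed.
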